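(* Let $\mathcal A$ be an arrangement of linear subspaces in a complex vector space. Then the relative atomic differential graded algebra $D_{\mathcal A}$ of $\mathcal A$ is quasi-isomorphic to the differential graded algebra $\mathrm{CM}_{\mathcal A}$.
   Context: $\mathcal A$ is a finite arrangement of proper linear subspaces of a finite-dimensional complex vector space $V$, none of which contains another. Its intersection lattice $\mathcal L$ is the set of all intersections of subfamilies of $\mathcal A$ (the empty intersection being $V=\hat 0$), ordered by reverse inclusion. Its set of atoms $\mathfrak A(\mathcal L)$ is in bijection with $\mathcal A$; a linear order on $\mathfrak A(\mathcal L)$ is fixed. $\mathrm{cd}\,A$ is the complex codimension of $A\in\mathcal L$ in $V$; $\bigvee$ and $\vee$ are joins in $\mathcal L$, $\bigvee\emptyset=\hat 0$. For a permutation, $\mathrm{sgn}\in\{0,1\}$ denotes its parity. All coefficients are in $\mathbb Q$. Quasi-isomorphic: two d.g.a.'s are quasi-isomorphic if they are connected by a finite sequence of d.g.a.'s in which each neighboring pair is connected, in at least one direction, by a d.g.a. morphism inducing an isomorphism in cohomology. The d.g.a. $D_{\mathcal A}$: it has as basis all subsets $\sigma\subseteq\mathfrak A(\mathcal L)$, graded by $\deg\sigma=2\,\mathrm{cd}\bigvee\sigma-|\sigma|$. For $\sigma=\{i_1<\dots<i_k\}$ and $\sigma_j=\sigma\setminus\{i_j\}$, $d\sigma=\sum_{j:\,\bigvee\sigma_j=\bigvee\sigma}(-1)^j\sigma_j$. The product is $\sigma\cdot\tau=(-1)^{\mathrm{sgn}\,\epsilon(\sigma,\tau)}\sigma\cup\tau$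 if $\mathrm{cd}\bigvee\sigma+\mathrm{cd}\bigvee\tau=\mathrm{cd}\bigvee(\sigma\cup\tau)$, and $0$ otherwise, where $\epsilon(\sigma,\tau)$ is the permutation that, applied to $\sigma\cup\tau$ in the induced linear order, places the elements of $\tau$ after those of $\sigma$, both in the induced order. The d.g.a. $\mathrm{CM}_{\mathcal A}$: $\mathrm{CM}_{\mathcal A}=\bigoplus_{A\in\mathcal L}F(\hat 0,A)$, where for $A>\hat 0$, $F(\hat 0,A)$ is the augmented simplicial chain complex of the flag (order) complex of the open interval $(\hat 0,A)$; its basis consists of all flags $T: A_1<\dots<A_p$ in $(\hat 0,A)$, $p\ge 0$ (including the empty flag). Such a flag in the summand $F(\hat 0,A)$ has degree $2\,\mathrm{cd}\,A-p-1$, and $dT=\sum_{j=1}^p(-1)^j\,T\setminus\{A_j\}$. For $A=\hat 0$ the summand $F(\hat 0,\hat 0)$ is $\mathbb Q$ in degree $0$, spanned by the unit of the algebra. For a flag $T$ in $F(\hat 0,A)$ let $\overline T$ be the flag extended by the element $A$; for a nonempty flag $T$ let $\underline T$ be $T$ with its maximal element removed. For an ordered collection $\mathcal C=(C_1,\dots,C_t)$ of lattice elements, $\lambda(\mathcal C)$ is the chain $C_1<C_1\vee C_2<\dots<\bigvee_{i=1}^tC_i$, set to zero if repetitions occur among these joins. For $A,B>\hat 0$ and flags $T_A: A_1<\dots<A_p$ in $F(\hat 0,A)$, $T_B: B_1<\dots<B_q$ in $F(\hat 0,B)$, let $\mathfrak S_{p+1,q+1}\subset\mathfrak S_{p+q+2}$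 be the set of shuffle permutations (those preserving the relative order of the first $p+1$ and of the last $q+1$ elements), and let $(\overline T_A,\overline T_B)^\pi=\lambda(\pi(\overline T_A,\overline T_B))$, where $\pi$ is applied to the list of elements of $\overline T_A$ in ascending order followed by those of $\overline T_B$ in ascending order. The product is $$T_A\cdot T_B=\begin{cases}\displaystyle\sum_{\pi\in\mathfrak S_{p+1,q+1}}(-1)^{\mathrm{sgn}\,\pi}\;\underline{(\overline T_A,\overline T_B)^\pi} & \text{if }\mathrm{cd}\,A+\mathrm{cd}\,B=\mathrm{cd}(A\vee B),\\ 0&\text{otherwise},\end{cases}$$ an element of $F(\hat 0,A\vee B)$. It is known that both $D_{\mathcal A}$ and $\mathrm{CM}_{\mathcal A}$ are differential graded algebras. *)

(* Defs.v *)
From HB Require Import structures.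
From mathcomp Require Export all_boot all_algebra reals.
From mathcomp Require Import all_order all_fingroup.
From mathcomp.real_closed Require Export complex.

Set Implicit Arguments.
Unset Strict Implicit.
Unset Printing Implicit Defensive.

Import Order.TTheory GRing.Theory.

Local Open Scope ring_scope.

(** * Differential graded algebras over the rationals *)

(* The grading is internal: [dg_homog n] is the subspace of homogeneous
   elements of degree [n] of the total space. Degrees range over [int], since
   the atomic complex below may have basis elements of negative degree. *)
Record dg_data := DgData {
  dg_space :> lmodType rat;
  dg_homog : int -> dg_space -> Prop;
  dg_diff : dg_space -> dg_space;
  dg_mul : dg_space -> dg_space -> dg_space;
  dg_one : dg_space
}.

Record is_dga (X : dg_data) : Prop := IsDga {
  dga_homog0 : forall n, dg_homog n (0 : X);
  dga_homogP : forall n (c : rat) (x y : X),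
    dg_homog n x -> dg_homog n y -> dg_homog n (c *: x + y);
  dga_decomp : forall x : X, exists (s : seq int) (f : int -> X),
    (forall n, dg_homog n (f n)) /\ x = \sum_(n <- s) f n;
  dga_direct : forall (s : seq int) (f : int -> X),
    uniq s -> (forall n, dg_homog n (f n)) -> \sum_(n <- s) f n = 0 ->
    forall n, n \in s -> f n = 0;
  dga_mul_linl : forall (c : rat) (x y z : X),
    dg_mul (c *: x + y) z = c *: dg_mul x z + dg_mul y z;
  dga_mul_linr : forall (c : rat) (x y z : X),
    dg_mul z (c *: x + y) = c *: dg_mul z x + dg_mul z y;
  dga_mulA : forall x y z : X, dg_mul x (dg_mul y z) = dg_mul (dg_mul x y) z;
  dga_mul1l : forall x : X, dg_mul (dg_one X) x = x;
  dga_mul1r : forall x : X, dg_mul x (dg_one X) = x;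
  dga_homog1 : dg_homog 0 (dg_one X);
  dga_homogM : forall m n (x y : X),
    dg_homog m x -> dg_homog n y -> dg_homog (m + n) (dg_mul x y);
  dga_diff_lin : forall (c : rat) (x y : X),
    dg_diff (c *: x + y) = c *: dg_diff x + dg_diff y;
  dga_homogd : forall n (x : X), dg_homog n x -> dg_homog (n + 1) (dg_diff x);
  dga_diffK : forall x : X, dg_diff (dg_diff x) = 0;
  dga_leibniz : forall n (x y : X), dg_homog n x ->
    dg_diff (dg_mul x y) =
      dg_mul (dg_diff x) y + (-1) ^ n *: dg_mul x (dg_diff y)
}.

Record dga_morphism (X Y : dg_data) (f : X -> Y) : Prop := DgaMorphism {
  dgm_lin : forall (c : rat) (x y : X), f (c *: x + y) = c *: f x + f y;
  dgm_homog : forall n (x : X), dg_homog n x -> dg_homog n (f x);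
  dgm_diff : forall x : X, f (dg_diff x) = dg_diff (f x);
  dgm_mul : forall x y : X, f (dg_mul x y) = dg_mul (f x) (f y);
  dgm_one : f (dg_one X) = dg_one Y
}.

(* The cohomology in degree [n] is the quotient of the cocycles of degree [n]
   by the relation [cohomologous n]. *)
Definition cocycle (X : dg_data) (n : int) (x : X) : Prop :=
  dg_homog n x /\ dg_diff x = 0.

Definition cohomologous (X : dg_data) (n : int) (x y : X) : Prop :=
  exists w : X, dg_homog (n - 1) w /\ x - y = dg_diff w.

(* Injectivity and surjectivity of the induced maps H^n(X) -> H^n(Y). *)
Definition cohomology_iso (X Y : dg_data) (f : X -> Y) : Prop :=
  forall n : int,
    (forall x y : X, cocycle n x -> cocycle n y ->
       cohomologous n (f x) (f y) -> cohomologous n x y) /\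
    (forall z : Y, cocycle n z ->
       exists x : X, cocycle n x /\ cohomologous n (f x) z).

Definition quasi_iso_to (X Y : dg_data) : Prop :=
  exists f : X -> Y, dga_morphism f /\ cohomology_iso f.

Inductive quasi_isomorphic : dg_data -> dg_data -> Prop :=
| qi_refl X : is_dga X -> quasi_isomorphic X X
| qi_step X Y Z : is_dga X -> quasi_iso_to X Y \/ quasi_iso_to Y X ->
    quasi_isomorphic Y Z -> quasi_isomorphic X Z.

(** * Rational vector spaces with a finite basis *)

Definition freeQ (B : finType) := {ffun B -> rat^o}.

Definition bvec (B : finType) (b : B) : freeQ B := [ffun x => (x == b)%:R].

Definition lin_ext (B : finType) (W : lmodType rat) (g : B -> W)
    (v : freeQ B) : W :=
  \sum_b v b *: g b.

Definition bilin_ext (B : finType) (W : lmodType rat) (g : B -> B -> W)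
    (u v : freeQ B) : W :=
  \sum_a \sum_b (u a * v b) *: g a b.

Definition basis_homog (B : finType) (deg : B -> int) (n : int)
    (v : freeQ B) : Prop :=
  forall b, v b != 0 -> deg b = n.

(** * Permutations of lists and shuffles *)

(* The entry at position [i] is moved to position [pi i]. *)
Definition permute (T : Type) (x0 : T) (m : nat) (pi : 'S_m) (s : seq T) :
    seq T :=
  [seq nth x0 s ((pi^-1)%g i) | i <- enum 'I_m].

Definition shuffle (p q : nat) (pi : 'S_(p + q)) : bool :=
  [forall i : 'I_(p + q), forall j : 'I_(p + q),
     [&& (i < j)%N & (j < p)%N || (p <= i)%N] ==> (pi i < pi j)%N].

(** * The intersection lattice of an arrangement *)

Section Arrangement.

Variables (K : fieldType) (V : vectType K) (n : nat) (U : 'I_n -> {vspace V}).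

Definition inter (s : {set 'I_n}) : {vspace V} := (\bigcap_(i in s) U i)%VS.

Definition ilat := seq_sub [seq inter s | s : {set 'I_n}].

HB.instance Definition _ := Finite.on ilat.
HB.instance Definition _ := SubType.on ilat.

Lemma inter_in s : inter s \in [seq inter s | s : {set 'I_n}].
Proof. exact: codom_f. Qed.

Definition ilat_of (s : {set 'I_n}) : ilat := SeqSub (inter_in s).

Definition ilat_le (x y : ilat) : bool := (ssval y <= ssval x)%VS.

Fact ilat_le_refl : reflexive ilat_le.
Proof. by move=> x; exact: subvv. Qed.

Fact ilat_le_anti : antisymmetric ilat_le.
Proof.
move=> x y /andP[yx xy]; apply: val_inj; apply: subv_anti.
by apply/andP.
Qed.

Fact ilat_le_trans : transitive ilat_le.
Proof. by move=> y x z xy yz; exact: subv_trans yz xy. Qed.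

Fact ilat_display : Order.disp_t. Proof. exact: Order.Disp tt tt. Qed.

HB.instance Definition _ := Order.Le_isPOrder.Build ilat_display ilat
  ilat_le_refl ilat_le_anti ilat_le_trans.

Fact cap_in (x y : ilat) :
  (ssval x :&: ssval y)%VS \in [seq inter s | s : {set 'I_n}].
Proof.
case: x y => [x xP] [y yP] /=.
have /codomP[S ->] := xP; have /codomP[T ->] := yP.
suff -> : (inter S :&: inter T)%VS = inter (S :|: T) by exact: inter_in.
apply: subv_anti; apply/andP; split.
  apply/subv_bigcapP => i; rewrite inE => /orP[iS|iT].
    by apply: subv_trans (capvSl _ _) _; exact: bigcapv_inf iS (subvv _).
  by apply: subv_trans (capvSr _ _) _; exact: bigcapv_inf iT (subvv _).
rewrite subv_cap; apply/andP.
by split; apply/subv_bigcapP => i iX;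
  apply: bigcapv_inf (subvv _); rewrite inE iX ?orbT.
Qed.

Definition ilat_join (x y : ilat) : ilat := SeqSub (cap_in x y).

Fact ilat_leUx (x y z : ilat) :
  (ilat_join x y <= z)%O = (x <= z)%O && (y <= z)%O.
Proof. exact: subv_cap. Qed.

HB.instance Definition _ :=
  Order.POrder_isJoinSemilattice.Build ilat_display ilat ilat_leUx.

Fact ilat_le0x (x : ilat) : (ilat_of set0 <= x)%O.
Proof.
by rewrite /Order.le /= /ilat_le /= /inter big_set0 subvf.
Qed.

HB.instance Definition _ :=
  Order.hasBottom.Build ilat_display ilat ilat_le0x.

Definition cd (x : ilat) : nat := (\dim {:V} - \dim (ssval x))%N.

(** * The relative atomic algebra *)

(* The atoms are indexed by ['I_n] and ordered by their index. *)
Definition atom (i : 'I_n) : ilat := ilat_of [set i].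

Definition joins (s : {set 'I_n}) : ilat := (\join_(i in s) atom i)%O.

Definition D_deg (s : {set 'I_n}) : int :=
  (2 * cd (joins s))%N%:Z - #|s|%:Z.

(* The cardinal in the exponent is the position j (counted from 1) of
   i = i_j in s = {i_1 < ... < i_k}. *)
Definition D_diff_basis (s : {set 'I_n}) : freeQ {set 'I_n} :=
  \sum_(i in s | joins (s :\ i) == joins s)
     (-1) ^+ #|[set k in s | (k <= i)%N]| *: bvec (s :\ i).

(* [enum] lists a set of ordinals in increasing order. For disjoint s and t
   there is exactly one such permutation e; sets that meet never satisfy the
   codimension condition of the product. *)
Definition eps_sign (s t : {set 'I_n}) : rat :=
  if [pick e : 'S_#|s :|: t| |
        [seq val i | i <- enum s ++ enum t] ==
        permute 0%N e [seq val i | i <- enum (s :|: t)]] is Some e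
  then (-1) ^+ e else 0.

Definition D_mul_basis (s t : {set 'I_n}) : freeQ {set 'I_n} :=
  if (cd (joins s) + cd (joins t) == cd (joins (s :|: t)))%N
  then eps_sign s t *: bvec (s :|: t) else 0.

Definition D_dga : dg_data :=
  @DgData (freeQ {set 'I_n}) (basis_homog D_deg)
    (lin_ext D_diff_basis) (bilin_ext D_mul_basis) (bvec set0).

(** * The algebra of flags *)

Definition is_flag (AT : ilat * {set ilat}) : bool :=
  [forall x in AT.2, (\bot < x < AT.1)%O] &&
  [forall x in AT.2, forall y in AT.2, (x >=< y)%O].

(* A pair (A, T) is the flag T seen as a basis element of F(0, A). For A = 0
   the only flag is the empty one, which spans F(0, 0). *)
Definition flag : finType := {AT : ilat * {set ilat} | is_flag AT}.

Definition flag_vec (A : ilat) (T : {set ilat}) : freeQ flag :=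
  if insub (A, T) is Some b then bvec (b : flag) else 0.

Definition CM_deg (b : flag) : int :=
  let: (A, T) := val b in
  if A == \bot%O then 0 else (2 * cd A)%N%:Z - #|T|%:Z - 1.

Definition CM_diff_basis (b : flag) : freeQ flag :=
  let: (A, T) := val b in
  \sum_(x in T)
     (-1) ^+ #|[set y in T | (y <= x)%O]| *: flag_vec A (T :\ x).

Definition ext_list (A : ilat) (T : {set ilat}) : seq ilat :=
  rcons (sort <=%O (enum T)) A.

Definition lambda (C : seq ilat) : seq ilat := scanl Order.join \bot%O C.

(* The chain [lambda C] without its maximal element, as an element of
   F(0, M) where M is that maximal element, or 0 if [lambda C] has
   repetitions. *)
Definition lambda_vec (C : seq ilat) : freeQ flag :=
  let M := last \bot%O (lambda C) in
  if uniq (lambda C) then flag_vec M ([set x in lambda C] :\ M) else 0.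

Definition CM_mul_basis (a b : flag) : freeQ flag :=
  let: (A, T) := val a in
  let: (B, T') := val b in
  if A == \bot%O then bvec b
  else if B == \bot%O then bvec a
  else if (cd A + cd B == cd (A `|` B)%O)%N then
    \sum_(pi : 'S_(#|T|.+1 + #|T'|.+1) | shuffle pi)
       (-1) ^+ pi *: lambda_vec
         (permute \bot%O pi (ext_list A T ++ ext_list B T'))
  else 0.

Definition CM_dga : dg_data :=
  @DgData (freeQ flag) (basis_homog CM_deg)
    (lin_ext CM_diff_basis) (bilin_ext CM_mul_basis) (flag_vec \bot%O set0).

End Arrangement.

(* Main.v *)
(** Both algebras are associated graded algebras of d.g.a.'s filtered by the
    intersection lattice. For [D_dga] it is the exterior algebra on the atoms
    with [d x_i = -1]. For [CM_dga] it is spanned by all chains in the lattice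
    without its bottom, with all faces as differential and the signed shuffles,
    followed by partial joins, as product: this is the bar construction of the
    commutative monoid of joins, normalized. Sending [x_i] to the one-element
    chain of the atom [i] extends to a morphism of filtered d.g.a.'s. For every
    [A] above the bottom, both subcomplexes of labels at most [A] are
    contractible, by multiplication with an element [x] such that [d x = -1];
    hence the mapping cone is acyclic on labels at most [A] for each [A], and
    then, by induction on [A], so is its associated graded piece at [A]. *)

From mathcomp Require Import all_order all_fingroup zify.
From mathcomp Require Import boolp.
Require Import Defs.

Set Implicit Arguments.
Unset Strict Implicit.
Unset Printing Implicit Defensive.

Import Order.TTheory GRing.Theory.

Local Open Scope ring_scope.

(** * Signed shuffles of words *)

(** The codimension condition kills many products, and identities checked directly would split into
    cases. In the filtered algebras the product is unconditional; the condition returns in the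
    graded ones, where subadditivity and strict monotonicity of the codimension make leading parts
    multiplicative. Likewise the face removing the top of a chain supplies the elements with
    [d x = -1], and disappears from the graded complex because it lowers the label.

    A chain is handled as a word of increments with the chain as its partial joins. On words, the
    Leibniz rule and associativity are formal; the price is to show that shuffling and merging
    respect the passage to chains, where repetitions become zero. Signed sums of words are evaluated
    against an arbitrary module-valued [F], which avoids a free module on infinitely many words.

    The part labelled by the bottom is not contractible: both complexes are spanned by the unit
    there, and the cone is acyclic because the unit goes to the unit. *)

Definition is_lin (M M' : lmodType rat) (f : M -> M') : Prop :=
  forall (c : rat) x y, f (c *: x + y) = c *: f x + f y.

Section IsLin.
Variables (M M' : lmodType rat) (f : M -> M').
Hypothesis f_lin : is_lin f.

Lemma lin0 : f 0 = 0.
Proof.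
by have := f_lin (-1) 0 0; rewrite scaler0 addr0 scaleN1r addNr.
Qed.

Lemma linD x y : f (x + y) = f x + f y.
Proof. by have := f_lin 1 x y; rewrite !scale1r. Qed.

Lemma linZ c x : f (c *: x) = c *: f x.
Proof. by have := f_lin c x 0; rewrite lin0 !addr0. Qed.

Lemma linN x : f (- x) = - f x.
Proof. by rewrite -scaleN1r linZ scaleN1r. Qed.

Lemma linB x y : f (x - y) = f x - f y.
Proof. by rewrite linD linN. Qed.

Lemma lin_sum (I : Type) (r : seq I) (P : pred I) (F : I -> M) :
  f (\sum_(i <- r | P i) F i) = \sum_(i <- r | P i) f (F i).
Proof. exact: (big_morph f linD lin0). Qed.

End IsLin.

Section Words.
Variables (T : Type) (M : lmodType rat).
Implicit Types (F G : seq T -> M) (u v w z : seq T).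

(* The signed sum of [F w] over all shuffles [w] of [u] and [v]. *)
Fixpoint shs F u v {struct u} : M :=
  if u is a :: u' then
    (fix shr F v {struct v} : M :=
       if v is b :: v' then
         shs (fun w => F (a :: w)) u' v
           + (-1) ^+ (size u) *: shr (fun w => F (b :: w)) v'
       else F u) F v
  else F v.

Arguments shs : simpl never.

Lemma shs0l F v : shs F [::] v = F v.
Proof. by []. Qed.

Lemma shs0r F u : shs F u [::] = F u.
Proof. by case: u. Qed.

Lemma shs_cons F a u b v : shs F (a :: u) (b :: v) =
  shs (fun w => F (a :: w)) u (b :: v)
    + (-1) ^+ (size u).+1 *: shs (fun w => F (b :: w)) (a :: u) v.
Proof. by []. Qed.

(** Each recursive call prepends a letter inside [F], so the induction has to quantify over [F]; its
    two hypotheses match the two terms of [shs_cons]. *)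
Lemma shs_ind (P : (seq T -> M) -> seq T -> seq T -> Prop) :
  (forall F v, P F [::] v) -> (forall F u, P F u [::]) ->
  (forall F a u b v, P (fun w => F (a :: w)) u (b :: v) ->
     P (fun w => F (b :: w)) (a :: u) v -> P F (a :: u) (b :: v)) ->
  forall F u v, P F u v.
Proof.
move=> P0l P0r PS F u; elim: u F => [|a u IHu] F v; first exact: P0l.
elim: v F => [|b v IHv] F; first exact: P0r.
by apply: PS.
Qed.

(** A shuffle has no letters besides those of [u] and [v]. Later [Q] singles out the lattice
    elements above the bottom. *)
Lemma eq_shs_in (Q : pred T) F G u v :
  (forall w, size w = (size u + size v)%N -> all Q w -> F w = G w) ->
  all Q u -> all Q v -> shs F u v = shs G u v.
Proof.
move: G; move: F u v; apply: shs_ind => [F v|F u|F a u b v IH1 IH2] G E.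
- by move=> _ Qv; apply: E.
- by move=> Qu _; rewrite !shs0r; apply: E; rewrite ?addn0.
move=> /= /andP[Qa Qu] /andP[Qb Qv].
rewrite !shs_cons; congr (_ + _ *: _); [apply: IH1 | apply: IH2] => //=.
- by move=> w sw Qw; apply: E; rewrite /= ?sw ?Qa ?addSn.
- by rewrite Qb.
- by move=> w sw Qw; apply: E; rewrite /= ?sw ?addnS ?addSn ?Qb.
- by rewrite Qa.
Qed.

Lemma eq_shs F G u v :
  (forall w, size w = (size u + size v)%N -> F w = G w) -> shs F u v = shs G u v.
Proof.
move=> E; apply: (@eq_shs_in predT); rewrite ?all_predT // => w sw _.
exact: E.
Qed.

Lemma shs_add F G u v : shs (fun w => F w + G w) u v = shs F u v + shs G u v.
Proof.
move: G; move: F u v; apply: shs_ind => [F v|F u|F a u b v IH1 IH2] G //.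
  by rewrite !shs0r.
by rewrite !shs_cons IH1 IH2 scalerDr addrACA.
Qed.

Lemma shsZ c F u v : shs (fun w => c *: F w) u v = c *: shs F u v.
Proof.
move: F u v; apply: shs_ind => [F v|F u|F a u b v IH1 IH2] //.
  by rewrite !shs0r.
by rewrite !shs_cons IH1 IH2 scalerDr !scalerA mulrC.
Qed.

Lemma shsN F u v : shs (fun w => - F w) u v = - shs F u v.
Proof.
by rewrite -scaleN1r -shsZ; apply: eq_shs => w _; rewrite scaleN1r.
Qed.

Lemma shs_eq0 F u v : (forall w, F w = 0) -> shs F u v = 0.
Proof.
move=> E; rewrite (@eq_shs _ (fun w => 0 *: F w)) ?shsZ ?scale0r //.
by move=> w _; rewrite scale0r.
Qed.

(** Exchanging the blocks reverses [size u * size v] pairs; in the recursion the two terms of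
    [shs_cons] trade places. *)
Lemma shsC F u v : shs F u v = (-1) ^+ (size u * size v) *: shs F v u.
Proof.
move: F u v; apply: shs_ind => [F v|F u|F a u b v IH1 IH2].
- by rewrite mul0n scale1r shs0r.
- by rewrite muln0 scale1r shs0r.
rewrite !shs_cons IH1 IH2 addrC scalerDr !scalerA -!exprD /=.
by congr (_ *: _ + _ *: _); rewrite -signr_odd -[RHS]signr_odd;
  rewrite !(oddD, oddM, oddS); case: (odd (size u)); case: (odd (size v)).
Qed.

End Words.

Arguments shs : simpl never.

Lemma shs_closed (T : eqType) (M : lmodType rat) (P : M -> Prop) (F : seq T -> M) u v :
  (forall c x y, P x -> P y -> P (x + c *: y)) ->
  (forall w, perm_eq w (u ++ v) -> P (F w)) -> P (shs F u v).
Proof.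
move=> PD; move: F u v; apply: shs_ind => [F v|F u|F a u b v IH1 IH2] E.
- exact: E.
- by rewrite shs0r; apply: E; rewrite cats0.
rewrite shs_cons; apply: PD; [apply: IH1 | apply: IH2] => w pw; apply: E.
  by rewrite /= perm_cons.
by rewrite -[b :: v]cat1s perm_sym perm_catCA perm_cons perm_sym.
Qed.

Lemma lin_shs (T : Type) (M M' : lmodType rat) (f : M -> M') (F : seq T -> M) u v :
  is_lin f -> f (shs F u v) = shs (fun w => f (F w)) u v.
Proof.
move=> fl; move: F u v; apply: shs_ind => [F v|F u|F a u b v IH1 IH2] //.
  by rewrite !shs0r.
by rewrite !shs_cons linD // linZ // IH1 IH2.
Qed.

(** Both sides range over the shuffles of three words, sorted by the word that provides the first
    letter. *)
Lemma shsA (T : Type) (M : lmodType rat) (F : seq T -> M) u v z :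
  shs (fun w => shs F w z) u v = shs (fun w => shs F u w) v z.
Proof.
elim: u F v z => [|a u IHu] F v z //.
elim: v F z => [|b v IHv] F z //.
elim: z F => [|c z IHz] F.
  rewrite shs0r; apply: eq_shs => w _; exact: shs0r.
have H1 e x y : shs (fun w => shs F (e :: w) (c :: z)) x y =
    shs (fun w => shs (fun w => F (e :: w)) w (c :: z)) x y
    + (-1) ^+ (size x + size y).+1
       *: shs (fun w => shs (fun w => F (c :: w)) (e :: w) z) x y.
  rewrite -shsZ -shs_add; apply: eq_shs => w sw.
  by rewrite shs_cons sw.
have H2 e x y : shs (fun w => shs F (a :: u) (e :: w)) x y =
    shs (fun w => shs (fun w => F (a :: w)) u (e :: w)) x y
    + (-1) ^+ (size u).+1
       *: shs (fun w => shs (fun w => F (e :: w)) (a :: u) w) x y.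
  by rewrite -shsZ -shs_add; apply: eq_shs => w _; rewrite shs_cons.
(* On the left the terms beginning with [c] come as two summands, according to whether [a] or [b] is
   ahead in the shuffle of [u] and [v]; this instance, once expanded, reassembles them. *)
have H3 := IHz (fun w => F (c :: w)).
rewrite shs_cons in H3.
rewrite [LHS]shs_cons [RHS]shs_cons !H1 !H2 IHu IHv -H3 [in LHS]shs_cons.
rewrite !scalerDr !scalerA -!exprD /= -!addrA; congr (_ + _).
rewrite [RHS]addrCA; congr (_ + _).
rewrite [LHS]addrCA; congr (_ + _).
by congr (_ *: _ + _ *: _); rewrite -signr_odd -[RHS]signr_odd;
  rewrite !(oddD, oddS); case: (odd (size u)); case: (odd (size v)).
Qed.

(* Decides an identity between signed sums in an abelian group by moving
   everything to the left-hand side and cancelling opposite terms. *)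
Ltac cancel_sums :=
  apply/subr0_eq; rewrite -[LHS]addr0 ?opprD ?opprK ?oppr0 -?addrA;
  repeat first
    [ rewrite add0r
    | rewrite addKr | rewrite addNKr
    | match goal with
      | |- - ?x + _ = _ => rewrite !(addrCA _ x) addNKr
      | |- ?x + _ = _ => rewrite !(addrCA _ (- x)) addKr
      end ]; rewrite ?addr0 //.

(** * The merging differential on words *)

Section Merge.
Variables (T : Type) (op : T -> T -> T).
Hypothesis opA : associative op.
Hypothesis opC : commutative op.

Section Defs.
Variable M : lmodType rat.
Implicit Types (F G : seq T -> M) (u v w : seq T).

(** The face of the word [a :: w] at its first letter; on the chain of partial joins it removes the
    first element. *)
Definition mg F a w : M := if w is c :: w' then F (op a c :: w') else F [::].

(* [bdm F w] is the signed sum of [F] over the words obtained from [w] by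
   merging two adjacent letters or deleting the last one. When [w] lists the
   successive increments of a chain of joins, these are its faces. *)
Fixpoint bdm F w : M :=
  if w is a :: w' then - mg F a w' - bdm (fun x => F (a :: x)) w' else 0.

Lemma bdm_cons F a w : bdm F (a :: w) = - mg F a w - bdm (fun x => F (a :: x)) w.
Proof. by []. Qed.

Lemma eq_bdm_in (Q : pred T) F G w :
  (forall a b, Q a -> Q b -> Q (op a b)) ->
  (forall x, (size x).+1 = size w -> all Q x -> F x = G x) ->
  all Q w -> bdm F w = bdm G w.
Proof.
move=> Qop; elim: w F G => [|a w IHw] F G E //= /andP[Qa Qw].
congr (- _ - _).
  case: w E Qw {IHw} => [|c w] E Qw; first exact: E.
  by case/andP: Qw => Qc Qw; apply: E => //=; rewrite Qop.
by apply: IHw => // x sx Qx; apply: E; rewrite /= ?sx ?Qa.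
Qed.

Lemma eq_bdm F G w : (forall x, (size x).+1 = size w -> F x = G x) ->
  bdm F w = bdm G w.
Proof.
move=> E; apply: (@eq_bdm_in predT); rewrite ?all_predT // => x sx _.
exact: E.
Qed.

Lemma bdmD F G w : bdm (fun x => F x + G x) w = bdm F w + bdm G w.
Proof.
elim: w F G => [|a w IHw] F G /=; first by rewrite addr0.
by rewrite IHw; case: w {IHw} => [|c w]; rewrite /=; cancel_sums.
Qed.

Lemma bdmZ k F w : bdm (fun x => k *: F x) w = k *: bdm F w.
Proof.
elim: w F => [|a w IHw] F /=; first by rewrite scaler0.
by rewrite IHw scalerBr scalerN; case: w {IHw}.
Qed.

Lemma bdmN F w : bdm (fun x => - F x) w = - bdm F w.
Proof.
by rewrite -scaleN1r -bdmZ; apply: eq_bdm => x _; rewrite scaleN1r.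
Qed.

(** By associativity, absorbing [a] into the first letter commutes with merging that letter with the
    next one; the later faces do not involve it. *)
Lemma bdm_mg F a w : bdm (mg F a) w = mg (bdm F) a w.
Proof.
case: w => [|c w] //; rewrite [in RHS]/mg !bdm_cons /=.
by congr (- _ - _); case: w => [|e w] //; rewrite /mg opA.
Qed.

Lemma bdmK F w : bdm (bdm F) w = 0.
Proof.
elim: w F => [|a w IHw] F //; rewrite bdm_cons -bdm_mg.
(* [bdm F (a :: x)] consists of the face at [a] and the faces beyond it. Two faces beyond [a]
   compose to zero by induction; the rest cancels the term rewritten by [bdm_mg]. *)
have -> : bdm (fun x => bdm F (a :: x)) w = - bdm (mg F a) w.
  rewrite -[RHS]subr0 -(IHw (fun x => F (a :: x))) -!bdmN -bdmD.
  by apply: eq_bdm => x _; rewrite bdm_cons.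
by rewrite opprK addNr.
Qed.

Lemma bdm_closed (P : M -> Prop) (Q : pred T) F w :
  P 0 -> (forall c x y, P x -> P y -> P (x + c *: y)) ->
  (forall a b, Q a -> Q b -> Q (op a b)) ->
  (forall x, (size x).+1 = size w -> all Q x -> P (F x)) ->
  all Q w -> P (bdm F w).
Proof.
move=> P0 PD Qop; have PN x : P x -> P (- x).
  by move=> Px; rewrite -[- x]add0r -scaleN1r; apply: PD.
elim: w F => [|a w IHw] F E //= /andP[Qa Qw].
rewrite -(scaleN1r (bdm _ _)); apply: PD.
  apply: PN; case: w E Qw {IHw} => [|c w] E Qw; first exact: E.
  by case/andP: Qw => Qc Qw; apply: E => //=; rewrite Qop.
by apply: IHw => // x sx Qx; apply: E; rewrite /= ?sx ?Qa.
Qed.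

(** Absorbing [a] into [u] before shuffling also produces words in which [b] precedes the merged
    letter: the second term removes them. The third adds the words where [b] follows [a] directly
    and is merged with it. *)
Lemma shs_mg F a u b v : shs (mg F a) u (b :: v) =
  mg (fun x => shs F x (b :: v)) a u
  - (-1) ^+ size u *: mg (fun x => shs (fun w => F (b :: w)) x v) a u
  + (-1) ^+ size u *: shs (fun w => F (op a b :: w)) u v.
Proof.
case: u => [|c u]; first by rewrite !shs0l /= !scale1r; cancel_sums.
by rewrite shs_cons /= shs_cons /=; cancel_sums.
Qed.

(** By commutativity the last term has the same words as the mixed term of [shs_mg]; the signs of
    [shs_cons] make the two cancel in [shs_bdm]. *)
Lemma shs_mgr F a u b v : shs (mg F b) (a :: u) v =
  mg (fun y => shs F (a :: u) y) b v
  - mg (fun y => shs (fun w => F (a :: w)) u y) b v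
  + shs (fun w => F (op a b :: w)) u v.
Proof.
case: v => [|c v]; first by rewrite !shs0r /= !shs0r opC; cancel_sums.
by rewrite shs_cons /= shs_cons (opC a b) /=; cancel_sums.
Qed.

(* Mergings of letters of different words cancel in pairs, because [op] is
   commutative. *)
Lemma shs_bdm F u v : shs (bdm F) u v =
  bdm (fun x => shs F x v) u + (-1) ^+ size u *: bdm (fun y => shs F u y) v.
Proof.
move: F u v; apply: shs_ind => [F v|F u|F a u b v IH1 IH2].
- by rewrite /= add0r scale1r.
- rewrite shs0r scaler0 addr0; apply: eq_bdm => x _; by rewrite shs0r.
have E1 : shs (fun w => bdm F (a :: w)) u (b :: v) =
    - shs (mg F a) u (b :: v) - shs (bdm (fun w => F (a :: w))) u (b :: v).
  by rewrite -!shsN -shs_add; apply: eq_shs.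
have E2 : shs (fun w => bdm F (b :: w)) (a :: u) v =
    - shs (mg F b) (a :: u) v - shs (bdm (fun w => F (b :: w))) (a :: u) v.
  by rewrite -!shsN -shs_add; apply: eq_shs.
have E3 : bdm (fun x => shs F (a :: x) (b :: v)) u =
    bdm (fun x => shs (fun w => F (a :: w)) x (b :: v)) u
    + (-1) ^+ size u *: bdm (fun x => shs (fun w => F (b :: w)) (a :: x) v) u.
  by rewrite -bdmZ -bdmD; apply: eq_bdm => x <-; rewrite shs_cons.
have E4 : bdm (fun y => shs F (a :: u) (b :: y)) v =
    bdm (fun y => shs (fun w => F (a :: w)) u (b :: y)) v
    + (-1) ^+ (size u).+1 *: bdm (fun y => shs (fun w => F (b :: w)) (a :: u) y) v.
  by rewrite -bdmZ -bdmD; apply: eq_bdm => y _; rewrite shs_cons.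
rewrite shs_cons E1 E2 IH1 IH2 !bdm_cons E3 E4 shs_mg shs_mgr /=.
rewrite exprS; set s := (-1) ^+ size u.
rewrite mulN1r !(scalerDr, scalerN, scaleNr, opprD, opprK).
cancel_sums.
Qed.

End Defs.

Lemma lin_bdm (M M' : lmodType rat) (f : M -> M') (F : seq T -> M) w :
  is_lin f -> f (bdm F w) = bdm (fun x => f (F x)) w.
Proof.
move=> fl; elim: w F => [|a w IHw] F /=; first exact: (lin0 fl).
by rewrite (linB fl) (linN fl) IHw; case: w {IHw}.
Qed.

End Merge.

(** * Sums over shuffle permutations *)

(** Splits a permutation into the position [k] that it moves to the front and a permutation of the
    rest, to match the recursion on lists. *)
Definition lift_pair (m : nat) (ks : 'I_m.+1 * 'S_m) : 'S_m.+1 :=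
  lift_perm ks.1 ord0 ks.2.

Lemma lift_pair_bij m : bijective (@lift_pair m).
Proof.
apply: inj_card_bij; last by rewrite card_prod !card_Sn card_ord.
move=> [k s] [k' s'] E; have Ek : k = k'.
  apply: (@perm_inj _ (lift_pair (k, s))).
  by rewrite {2}E /lift_pair !lift_perm_id.
rewrite -Ek in E *; congr (_, _); apply/perm.permP => i.
by apply: (@lift_inj _ ord0); rewrite -!(lift_perm_lift k); move: E; rewrite /lift_pair /= => ->.
Qed.

Lemma sum_lift_perm (M : zmodType) m (F : 'S_m.+1 -> M) :
  \sum_s F s = \sum_k \sum_s F (lift_perm k ord0 s).
Proof.
rewrite pair_big (reindex (@lift_pair m)) //=.
exact/onW_bij/lift_pair_bij.
Qed.

Definition del (T : Type) k (w : seq T) := take k w ++ drop k.+1 w.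

Lemma nth_del (T : Type) (x0 : T) k w i : nth x0 (del k w) i = nth x0 w (bump k i).
Proof.
rewrite /del nth_cat nth_drop size_take /bump.
have [ki|ik] := leqP k i.
  case: (ltnP k (size w)) => kw; rewrite ifF; try lia.
    by congr nth; lia.
  by rewrite !nth_default //; lia.
case: (ltnP k (size w)) => kw; first by rewrite ik nth_take.
by case: ltnP => iw; rewrite ?nth_take // !nth_default //; lia.
Qed.

Lemma permute_lift (T : Type) (x0 : T) m (k : 'I_m.+1) (s : 'S_m) w :
  permute x0 (lift_perm k ord0 s) w = nth x0 w k :: permute x0 s (del k w).
Proof.
rewrite /permute enum_ordSl /= lift_permV lift_perm_id; congr (_ :: _).
rewrite -map_comp; apply: eq_map => i /=.
by rewrite lift_perm_lift nth_del.
Qed.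

Lemma perm_permute (T : eqType) (x0 : T) m (s : 'S_m) w : size w = m ->
  perm_eq (permute x0 s w) w.
Proof.
move=> sw; rewrite -[X in perm_eq _ X](mkseq_nth x0) sw /mkseq -val_enum_ord.
rewrite /permute -map_comp (map_comp (fun i : 'I_m => nth x0 w i)).
apply: perm_map; apply: uniq_perm; rewrite ?enum_uniq //.
  by rewrite (map_inj_uniq perm_inj) enum_uniq.
move=> i; rewrite mem_enum; apply/mapP; exists (s i); rewrite ?mem_enum //.
by rewrite permK.
Qed.

(** [shuffle] with a length [m] that is not syntactically [p + q], so that induction on [m] needs no
    casts. *)
Definition shufflep m p (pi : 'S_m) : bool :=
  [forall i : 'I_m, forall j : 'I_m,
     [&& (i < j)%N & (j < p)%N || (p <= i)%N] ==> (pi i < pi j)%N].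

Lemma shufflepP m p (pi : 'S_m) :
  reflect (forall i j : 'I_m, (i < j)%N -> (j < p)%N || (p <= i)%N ->
             (pi i < pi j)%N) (shufflep p pi).
Proof.
apply: (iffP forallP) => [H i j ij pij|H i].
  by have /forallP/(_ j) := H i; rewrite ij pij.
by apply/forallP => j; apply/implyP => /andP[]; apply: H.
Qed.

(** Each block keeps its order, so only the first letter of one of the two blocks can reach the
    front. With an empty first block, [k = 0] falls under the second alternative. *)
Lemma shufflep_lift m p (k : 'I_m.+1) (s : 'S_m) : (p <= m.+1)%N ->
  shufflep p (lift_perm k ord0 s) =
  [&& (k == 0 :> nat), (0 < p)%N & shufflep p.-1 s]
  || ((k == p :> nat) && shufflep p s).
Proof.
move=> pm; apply/shufflepP/orP => [H|].
  have [k0|k0] := posnP k.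
    case: p pm H => [|p] pm H.
      right; rewrite ?k0 ?eqxx /=; apply/shufflepP => i j ij _.
      have := H (lift k i) (lift k j).
      by rewrite !lift_perm_lift /= /bump k0 /= !add1n !ltnS; apply.
    left; rewrite ?k0 /=; apply/shufflepP => i j ij pij.
    have := H (lift k i) (lift k j).
    by rewrite !lift_perm_lift /= /bump k0 /= !add1n !ltnS; apply.
  right; have kp : k = p :> nat.
    have kp1 : ~~ (k < p)%N.
      apply/negP => kp; have := H ord0 k k0; rewrite kp lift_perm_id.
      by move=> /(_ isT).
    have kp2 : ~~ (p < k)%N.
      apply/negP => kp; have pm' : (p < m.+1)%N by have := ltn_ord k; lia.
      have := H (Ordinal pm') k kp; rewrite /= leqnn orbT lift_perm_id.
      by move=> /(_ isT).
    lia.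
  rewrite kp eqxx; apply/shufflepP => i j ij pij.
  have := H (lift k i) (lift k j); rewrite !lift_perm_lift /= /bump kp /=.
  by rewrite !add1n !ltnS; apply; lia.
move=> H i j; case: (unliftP k i) => [i'|] ->; last first.
  by case: (unliftP k j) => [j'|] ->; rewrite ?ltnn // lift_perm_lift lift_perm_id.
case: (unliftP k j) => [j'|] -> /=; last first.
  by case: H => [/and3P[/eqP -> //]|/andP[/eqP -> _]]; rewrite /bump; lia.
rewrite !lift_perm_lift /= /bump /= !add1n !ltnS => ij pij.
by case: H => [/and3P[/eqP k0 p0 /shufflepP]|/andP[/eqP kp /shufflepP]];
  apply; lia.
Qed.

(** Moving position [k] to the front has sign [(-1) ^+ k]; for [k] the length of the first block
    this is the sign in [shs_cons]. *)
Lemma sum_shuffles (T : Type) (x0 : T) (M : lmodType rat) m (F : seq T -> M) u v :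
  (size u + size v)%N = m ->
  \sum_(pi : 'S_m | shufflep (size u) pi) (-1) ^+ pi *: F (permute x0 pi (u ++ v))
  = shs F u v.
Proof.
elim: m F u v => [|m IHm] F u v suv.
  case: u suv => // ; case: v => // _; rewrite big_mkcond /=.
  rewrite (big_pred1 1%g) => [|s]; last first.
    by apply/esym/eqP/perm.permP => -[].
  rewrite odd_perm1 scale1r /permute (size0nil (s := enum 'I_0)) ?size_enum_ord //.
  by case: shufflepP => // -[] [].
rewrite big_mkcond sum_lift_perm.
(* The shuffles that move position [k] to the front. Only [k = 0] and [k = size u] contribute. *)
pose S k := \sum_(s : 'S_m | shufflep (size u) (lift_perm k ord0 s))
   (-1) ^+ (lift_perm k ord0 s) *: F (permute x0 (lift_perm k ord0 s) (u ++ v)).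
rewrite (eq_bigr S) => [|k _]; last by rewrite -big_mkcond.
have SE (k : 'I_m.+1) u' v' : del k (u ++ v) = u' ++ v' ->
    (size u' + size v')%N = m ->
    (forall s : 'S_m, shufflep (size u) (lift_perm k ord0 s) = shufflep (size u') s) ->
    S k = (-1) ^+ k *: shs (fun w => F (nth x0 (u ++ v) k :: w)) u' v'.
  move=> E1 E2 E3; rewrite -(IHm _ _ _ E2) scaler_sumr /S.
  apply: eq_big => // s _; rewrite scalerA permute_lift E1; congr (_ *: _).
  by rewrite odd_lift_perm /= addbF signr_addb signr_odd.
have S0 (k : 'I_m.+1) : (k != 0 :> nat) || (size u == 0)%N ->
    k != size u :> nat -> S k = 0.
  move=> k0 ku; apply: big_pred0 => s; rewrite shufflep_lift; last by lia.
  by rewrite (negPf ku) /=; case/orP: k0 => [/negPf ->|/eqP ->]; rewrite ?andbF.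
case: u suv S SE S0 => [|a u] suv S SE S0.
  case: v suv S SE S0 => [|b v] //= suv S SE S0.
  rewrite (bigD1 ord0) //= big1 => [|k k0]; last by apply: S0; rewrite ?orbT.
  rewrite addr0 (SE ord0 [::] v) ?scale1r //=; first by rewrite /del /= drop0.
    by move: suv; rewrite add0n => -[].
  by move=> s; rewrite shufflep_lift // andbF.
rewrite (bigD1 ord0) //= (SE ord0 u v); first last.
- by move=> s; rewrite shufflep_lift /= ?orbF //; move: suv => /=; lia.
- by move: suv => /= -[].
- by rewrite /del /= drop0.
rewrite scale1r /=; case: v suv S SE S0 => [|b v] suv S SE S0.
  rewrite big1 ?addr0 ?shs0r // => k k0; apply: S0; first by rewrite k0.
  by have := ltn_ord k; move: suv => /=; lia.
have pm : (size (a :: u) < m.+1)%N by rewrite -suv /=; lia.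
rewrite (bigD1 (Ordinal pm)) //= big1 => [|k /andP[k0 kp]]; last first.
  by apply: S0; [rewrite k0 | apply: contraNneq kp => kp; apply/eqP/val_inj].
rewrite addr0 shs_cons (SE (Ordinal pm) (a :: u) v) /=; first last.
- by move=> s; rewrite shufflep_lift /= ?eqxx // ltnW.
- by move: suv => /=; lia.
- by rewrite /del /= take_cat drop_cat ltnn subnn take0 cats0 ltnNge leqnSn /= subSnn drop1.
by rewrite nth_cat ltnn subnn.
Qed.

(** * Signs of permutations and inversions *)

Fixpoint inversions (w : seq nat) : nat :=
  if w is a :: w' then count (fun b => b < a)%N w' + inversions w' else 0%N.

Lemma count_ltn_sorted (u : seq nat) k : sorted ltn u -> (k < size u)%N ->
  count (fun b => b < nth 0 u k)%N (del k u) = k.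
Proof.
elim: u k => [|a u IHu] [|k] //= su ku.
  rewrite /del /= drop0; apply/eqP; rewrite -[_ == _]negbK -lt0n -has_count.
  apply/hasPn => b bu; rewrite -leqNgt ltnW //.
  exact: (allP (order_path_min ltn_trans su)).
rewrite -/(del k u) (IHu _ (path_sorted su)) //.
by rewrite (allP (order_path_min ltn_trans su)) ?add1n ?mem_nth.
Qed.

Lemma sorted_del (u : seq nat) k : sorted ltn u -> sorted ltn (del k u).
Proof.
move=> su; apply: subseq_sorted su; first exact: ltn_trans.
rewrite -[X in subseq _ X](cat_take_drop k) cat_subseq //.
by rewrite -addn1 addnC -drop_drop drop_subseq.
Qed.

(** Bringing entry [k] of a sorted list to the front creates exactly [k] inversions, in agreement
    with the sign of [lift_perm]. *)
Lemma permute_inversions m (e : 'S_m) (u : seq nat) : sorted ltn u ->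
  size u = m -> (-1) ^+ e = (-1) ^+ inversions (permute 0%N e u) :> rat.
Proof.
elim: m e u => [|m IHm] e u su szu.
  have -> : e = 1%g by apply/perm.permP => -[].
  by rewrite odd_perm1 /permute (size0nil (s := enum 'I_0)) ?size_enum_ord.
have [g _ gK] := lift_pair_bij m; rewrite -(gK e).
case: (g e) => k s; rewrite /lift_pair /= permute_lift /=.
have dm : size (del k u) = m.
  by rewrite size_cat size_take size_drop szu ltn_ord; have := ltn_ord k; lia.
rewrite (permP (perm_permute 0%N s dm)) count_ltn_sorted ?szu //.
by rewrite odd_lift_perm addbF signr_addb signr_odd (IHm s _ (sorted_del k su) dm) exprD.
Qed.

(** * Vectors with prescribed support *)

Section FreeQ.
Variable B : finType.
Implicit Types (u v w : freeQ B) (Q : pred B).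

Lemma lin_ext_lin (W : lmodType rat) (g : B -> W) : is_lin (lin_ext g).
Proof.
move=> c x y; rewrite /lin_ext scaler_sumr -big_split /=.
by apply: eq_bigr => b _; rewrite !ffunE scalerDl scalerA.
Qed.

Lemma lin_ext_bvec (W : lmodType rat) (g : B -> W) b : lin_ext g (bvec b) = g b.
Proof.
rewrite /lin_ext (bigD1 b) //= big1 ?addr0 => [|c cb].
  by rewrite ffunE eqxx scale1r.
by rewrite ffunE (negPf cb) scale0r.
Qed.

Lemma bilin_ext_linl (W : lmodType rat) (g : B -> B -> W) v :
  is_lin (fun u => bilin_ext g u v).
Proof.
move=> c x y; rewrite /bilin_ext scaler_sumr -big_split /=.
apply: eq_bigr => a _; rewrite scaler_sumr -big_split /=.
by apply: eq_bigr => b _; rewrite !ffunE mulrDl scalerDl scalerA mulrA.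
Qed.

Lemma bilin_ext_linr (W : lmodType rat) (g : B -> B -> W) u :
  is_lin (bilin_ext g u).
Proof.
move=> c x y; rewrite /bilin_ext scaler_sumr -big_split /=.
apply: eq_bigr => a _; rewrite scaler_sumr -big_split /=.
by apply: eq_bigr => b _; rewrite !ffunE mulrDr scalerDl scalerA mulrCA.
Qed.

Lemma bilin_ext_bvecl (W : lmodType rat) (g : B -> B -> W) a v :
  bilin_ext g (bvec a) v = lin_ext (g a) v.
Proof.
rewrite /bilin_ext /lin_ext (bigD1 a) //= [X in _ + X]big1 ?addr0 => [|c ca].
  by apply: eq_bigr => b _; rewrite ffunE eqxx mul1r.
by apply: big1 => b _; rewrite ffunE (negPf ca) mul0r scale0r.
Qed.

Lemma bilin_ext_bvec (W : lmodType rat) (g : B -> B -> W) a b :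
  bilin_ext g (bvec a) (bvec b) = g a b.
Proof. by rewrite bilin_ext_bvecl lin_ext_bvec. Qed.

Definition supp Q v : Prop := forall b, v b != 0 -> Q b.

Lemma supp0 Q : supp Q 0.
Proof. by move=> b; rewrite ffunE eqxx. Qed.

Lemma suppP Q c u v : supp Q u -> supp Q v -> supp Q (u + c *: v).
Proof.
move=> su sv b; rewrite !ffunE.
have [-> | /su //] := eqVneq (u b) 0.
have [-> | /sv //] := eqVneq (v b) 0.
by rewrite scaler0 addr0 eqxx.
Qed.

Lemma suppD Q u v : supp Q u -> supp Q v -> supp Q (u + v).
Proof. by move=> su sv; rewrite -[v]scale1r; exact: suppP. Qed.

Lemma suppZ Q c u : supp Q u -> supp Q (c *: u).
Proof. by move=> su; rewrite -[_ *: _]add0r; apply: suppP => //; exact: supp0. Qed.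

Lemma suppN Q u : supp Q u -> supp Q (- u).
Proof. by rewrite -scaleN1r; exact: suppZ. Qed.

Lemma supp_sum Q (I : Type) (r : seq I) (P : pred I) (F : I -> freeQ B) :
  (forall i, P i -> supp Q (F i)) -> supp Q (\sum_(i <- r | P i) F i).
Proof. by move=> H; apply: big_ind H => //; [exact: supp0 | exact: suppD]. Qed.

Lemma supp_bvec Q b : Q b -> supp Q (bvec b).
Proof. by move=> Qb c; rewrite ffunE; case: (c =P b) => [->|]. Qed.

Lemma sub_supp Q Q' u : supp Q u -> (forall b, Q b -> Q' b) -> supp Q' u.
Proof. by move=> su QQ b /su/QQ. Qed.

Lemma suppT v : supp predT v.
Proof. by []. Qed.

Lemma supp_expand Q v : supp Q v -> v = \sum_(b | Q b) v b *: bvec b.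
Proof.
move=> sv; apply/ffunP => c; rewrite sum_ffunE.
have [Qc|nQc] := boolP (Q c).
  rewrite (bigD1 c) //= !ffunE eqxx big1 => [|b /andP[_ bc]].
    by rewrite addr0 /GRing.scale /= mulr1.
  by rewrite !ffunE eq_sym (negPf bc) scaler0.
rewrite big1 => [|b Qb]; last first.
  by rewrite !ffunE; case: (c =P b) nQc => [->|_ _]; rewrite ?Qb ?scaler0.
by apply/eqP/negPn; apply: contra nQc => /sv.
Qed.

Lemma eq_lin_supp (W : lmodType rat) (f g : freeQ B -> W) Q v :
  is_lin f -> is_lin g -> supp Q v ->
  (forall b, Q b -> f (bvec b) = g (bvec b)) -> f v = g v.
Proof.
move=> fl gl /supp_expand -> E; rewrite (lin_sum fl) (lin_sum gl).
by apply: eq_bigr => b Qb; rewrite (linZ fl) (linZ gl) E.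
Qed.

Lemma eq_lin (W : lmodType rat) (f g : freeQ B -> W) v :
  is_lin f -> is_lin g -> (forall b, f (bvec b) = g (bvec b)) -> f v = g v.
Proof. by move=> fl gl E; apply: (eq_lin_supp (Q := predT)). Qed.

Lemma is_lin_comp (M M' M'' : lmodType rat) (f : M' -> M'') (g : M -> M') :
  is_lin f -> is_lin g -> is_lin (fun x => f (g x)).
Proof. by move=> fl gl c x y; rewrite gl fl. Qed.

Lemma is_linD (M M' : lmodType rat) (f g : M -> M') :
  is_lin f -> is_lin g -> is_lin (fun x => f x + g x).
Proof. by move=> fl gl c x y; rewrite gl fl scalerDr addrACA. Qed.

Lemma is_linZ (M M' : lmodType rat) k (f : M -> M') :
  is_lin f -> is_lin (fun x => k *: f x).
Proof. by move=> fl c x y; rewrite fl scalerDr !scalerA mulrC. Qed.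

Lemma is_lin0 (M M' : lmodType rat) : is_lin (fun _ : M => 0 : M').
Proof. by move=> c x y; rewrite scaler0 addr0. Qed.

Definition restr Q v : freeQ B := [ffun b => if Q b then v b else 0].

Lemma restr_lin Q : is_lin (restr Q).
Proof.
by move=> c x y; apply/ffunP => b; rewrite !ffunE; case: ifP; rewrite ?scaler0 ?addr0.
Qed.

Lemma supp_restr Q Q' v : supp Q' v -> supp (fun b => Q b && Q' b) (restr Q v).
Proof. by move=> sv b; rewrite ffunE; case: ifP; rewrite ?eqxx // => Qb /sv Qb'; apply/andP. Qed.

Lemma restr_id Q v : supp Q v -> restr Q v = v.
Proof.
move=> sv; apply/ffunP => b; rewrite ffunE; case: ifPn => // nQ.
by apply/eqP; rewrite eq_sym; apply/negPn; apply: contra nQ => /sv.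
Qed.

Lemma restr_eq0 Q v : supp (predC Q) v -> restr Q v = 0.
Proof.
move=> sv; apply/ffunP => b; rewrite !ffunE; case: ifP => // Qb.
by apply/eqP/negPn; apply: contraL Qb => /sv.
Qed.

Lemma restr_bvec Q b : restr Q (bvec b) = if Q b then bvec b else 0.
Proof.
by case: ifP => Qb; [rewrite restr_id | rewrite restr_eq0] => //; apply: supp_bvec;
  rewrite /= ?Qb.
Qed.

End FreeQ.

Lemma supp_lin (B B' : finType) (f : freeQ B -> freeQ B') Q Q' v :
  is_lin f -> supp Q v -> (forall b, Q b -> supp Q' (f (bvec b))) -> supp Q' (f v).
Proof.
move=> fl /supp_expand -> H; rewrite (lin_sum fl); apply: supp_sum => b Qb.
by rewrite (linZ fl); apply: suppZ; exact: H.
Qed.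

Lemma supp_lin_ext (B B' : finType) (g : B -> freeQ B') Q Q' v :
  supp Q v -> (forall b, Q b -> supp Q' (g b)) -> supp Q' (lin_ext g v).
Proof.
move=> sv H; apply: (supp_lin (lin_ext_lin g) sv) => b Qb.
by rewrite lin_ext_bvec; exact: H.
Qed.

Lemma supp_bilin_ext (B B' : finType) (g : B -> B -> freeQ B') Q Q' Q'' u v :
  supp Q u -> supp Q' v -> (forall a b, Q a -> Q' b -> supp Q'' (g a b)) ->
  supp Q'' (bilin_ext g u v).
Proof.
move=> su sv H; apply: (supp_lin (bilin_ext_linl g v) su) => a Qa.
by rewrite bilin_ext_bvecl; apply: (supp_lin_ext sv) => b Qb; exact: H.
Qed.

Lemma basis_homog_direct (B : finType) (deg : B -> int) (s : seq int)
    (f : int -> freeQ B) : uniq s -> (forall n, basis_homog deg n (f n)) ->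
  \sum_(n <- s) f n = 0 -> forall n, n \in s -> f n = 0.
Proof.
move=> us fh f0 n ns; apply/ffunP => b.
have := congr1 (fun v : freeQ B => v b) f0.
rewrite sum_ffunE (bigD1_seq n) //= !ffunE.
have [->|fnb] := eqVneq (f n b) 0; first by [].
rewrite big1 ?addr0 // => m mn; apply/eqP/negPn; apply: contra mn => /fh <-.
by rewrite (fh n b fnb).
Qed.

Lemma basis_homog_decomp (B : finType) (deg : B -> int) (x : freeQ B) :
  exists (s : seq int) (f : int -> freeQ B),
    (forall n, basis_homog deg n (f n)) /\ x = \sum_(n <- s) f n.
Proof.
exists (undup [seq deg b | b <- enum B]), (fun n => restr (fun b => deg b == n) x).
split=> [n b|]; first by rewrite ffunE; case: (deg b =P n) => [-> //|_]; rewrite eqxx.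
apply/ffunP => b; rewrite sum_ffunE (bigD1_seq (deg b)) ?undup_uniq //=; last first.
  by rewrite mem_undup map_f // mem_enum.
rewrite ffunE eqxx big1 ?addr0 // => n nb.
by rewrite ffunE eq_sym (negPf nb).
Qed.

(** * Filtered algebras and their associated graded algebras *)

Section Filtered.
Variables (disp : Order.disp_t) (L : bJoinSemilatticeType disp) (cdim : L -> nat).

Record codim_axioms : Prop := CodimAxioms {
  cdim0 : cdim \bot%O = 0%N;
  cdimU : forall x y, (cdim (x `|` y)%O <= cdim x + cdim y)%N;
  cdim_lt : forall x y, (x < y)%O -> (cdim x < cdim y)%N
}.

(** [flab] gives the filtration and [fsz] a homological degree, lowered by the differential; the
    cohomological degree appears only in [gr_deg]. *)
Record filt_data := FiltData {
  fbase : finType;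
  flab : fbase -> L;
  fsz : fbase -> nat;
  fdiff : fbase -> freeQ fbase;
  fmul : fbase -> fbase -> freeQ fbase;
  fone : fbase
}.

Record is_filt_dga (X : filt_data) : Prop := IsFiltDga {
  flab1 : flab (fone X) = \bot%O;
  fsz1 : fsz (fone X) = 0%N;
  fdiff_supp : forall b : fbase X,
    supp (fun c => (flab c <= flab b)%O && ((fsz c).+1 == fsz b)) (fdiff b);
  fmul_supp : forall a b : fbase X,
    supp (fun c => (flab c == flab a `|` flab b)%O && (fsz c == fsz a + fsz b)%N)
      (fmul a b);
  fdiffK : forall b : fbase X, lin_ext (@fdiff X) (fdiff b) = 0;
  fmulA : forall a b c : fbase X,
    bilin_ext (@fmul X) (bvec a) (fmul b c) = bilin_ext (@fmul X) (fmul a b) (bvec c);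
  fmul1l : forall b : fbase X, fmul (fone X) b = bvec b;
  fmul1r : forall b : fbase X, fmul b (fone X) = bvec b;
  fleibniz : forall a b : fbase X, lin_ext (@fdiff X) (fmul a b) =
    bilin_ext (@fmul X) (fdiff a) (bvec b)
    + (-1) ^+ fsz a *: bilin_ext (@fmul X) (bvec a) (fdiff b)
}.

Arguments fdiff_supp [X] _ b.
Arguments fmul_supp [X] _ a b.

Definition additive_labels x y := (cdim x + cdim y == cdim (x `|` y)%O)%N.

Section Graded.
Variable X : filt_data.
Implicit Types (a b c : fbase X) (u v w : freeQ (fbase X)).

Definition gr_deg b : int := (2 * cdim (flab b))%N%:Z - (fsz b)%:Z.
Definition gr_diff b := restr (fun c => flab c == flab b) (fdiff b).
Definition gr_mul a b := if additive_labels (flab a) (flab b) then fmul a b else 0.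

Definition gr : dg_data :=
  @DgData (freeQ (fbase X)) (basis_homog gr_deg)
    (lin_ext gr_diff) (bilin_ext gr_mul) (bvec (fone X)).

Hypothesis cdP : codim_axioms.
Hypothesis XP : is_filt_dga X.

Definition with_lab (x : L) b := flab b == x.
Definition below_lab (x : L) b := (flab b <= x)%O.

(** Twice the codimension is even, so the Leibniz signs for both degrees agree. *)
Lemma gr_deg_sign b : (-1) ^ gr_deg b = (-1) ^+ fsz b :> rat.
Proof.
rewrite /gr_deg expfzDr ?oppr_eq0 ?oner_eq0 // -exprnP exprM sqrrN !expr1n mul1r.
by rewrite -exprz_inv invrN invr1.
Qed.

(** The differential never raises labels, so components strictly below [x] contribute nothing at
    [x]. *)
Lemma lin_ext_gr_diff x v : supp (below_lab x) v ->
  lin_ext gr_diff (restr (with_lab x) v) = restr (with_lab x) (lin_ext (@fdiff X) v).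
Proof.
move=> sv.
apply: (eq_lin_supp (f := fun v => lin_ext gr_diff (restr (with_lab x) v))
  (g := fun v => restr (with_lab x) (lin_ext (@fdiff X) v)) _ _ sv) => [||b bx].
- exact: is_lin_comp (lin_ext_lin _) (restr_lin _).
- exact: is_lin_comp (restr_lin _) (lin_ext_lin _).
rewrite restr_bvec lin_ext_bvec; case: ifPn => [/eqP bx'|bx'].
  by rewrite lin_ext_bvec /gr_diff bx'.
rewrite (lin0 (lin_ext_lin _)) restr_eq0 //.
apply: (sub_supp (fdiff_supp XP b)) => c /andP[cb _] /=.
apply: contra bx'; rewrite /with_lab => /eqP cx; rewrite eq_le [(_ <= x)%O]bx /=.
by rewrite -cx.
Qed.

Lemma with_lab_below x v : supp (with_lab x) v -> supp (below_lab x) v.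
Proof. by move=> sv; apply: sub_supp sv _ => b /eqP bx; rewrite /below_lab bx. Qed.

Lemma lin_ext_gr_diff_lab x v : supp (with_lab x) v ->
  lin_ext gr_diff v = restr (with_lab x) (lin_ext (@fdiff X) v).
Proof.
by move=> sv; rewrite -lin_ext_gr_diff ?restr_id //; exact: with_lab_below.
Qed.

Lemma fmul_lab a b : supp (with_lab (flab a `|` flab b)%O) (fmul a b).
Proof. by apply: (sub_supp (fmul_supp XP a b)) => c /andP[]. Qed.

Arguments fmul_lab a b : clear implicits.

(** Otherwise the codimension of the join would be at most that of [x'] plus that of [y], which is
    too small. Hence lower terms of a factor never reach the leading label of an additive
    product. *)
Lemma additive_lt x' x y : (x' < x)%O -> additive_labels x y ->
  (x' `|` y != x `|` y)%O.
Proof.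
move=> /(cdim_lt cdP) lt /eqP add; apply/eqP => E.
by have := cdimU cdP x' y; rewrite E; lia.
Qed.

Lemma additiveC x y : additive_labels x y = additive_labels y x.
Proof. by rewrite /additive_labels addnC joinC. Qed.

Lemma gr_mul_restrl x b v : supp (below_lab x) v ->
  bilin_ext gr_mul (restr (with_lab x) v) (bvec b) =
  if additive_labels x (flab b) then
    restr (with_lab (x `|` flab b)%O) (bilin_ext (@fmul X) v (bvec b)) else 0.
Proof.
move=> sv; have [add|nadd] := boolP (additive_labels _ _); last first.
  apply: (eq_lin_supp (f := fun v => bilin_ext gr_mul (restr (with_lab x) v) (bvec b))
    (g := fun _ => 0) _ _ sv) => [||a ax].
  - exact: is_lin_comp (bilin_ext_linl _ _) (restr_lin _).
  - exact: is_lin0.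
  rewrite restr_bvec; case: ifPn => [/eqP ax'|_]; last exact: (lin0 (bilin_ext_linl _ _)).
  by rewrite bilin_ext_bvec /gr_mul ax' (negPf nadd).
apply: (eq_lin_supp (f := fun v => bilin_ext gr_mul (restr (with_lab x) v) (bvec b))
  (g := fun v => restr (with_lab (x `|` flab b)%O) (bilin_ext (@fmul X) v (bvec b)))
  _ _ sv) => [||a ax].
- exact: is_lin_comp (bilin_ext_linl _ _) (restr_lin _).
- exact: is_lin_comp (restr_lin _) (bilin_ext_linl _ _).
rewrite restr_bvec bilin_ext_bvec; case: ifPn => [/eqP ax'|ax'].
  by rewrite bilin_ext_bvec /gr_mul ax' add restr_id // -ax'; exact: fmul_lab.
rewrite (lin0 (bilin_ext_linl _ _)) restr_eq0 //.
apply: (sub_supp (fmul_lab a b)) => c /eqP cab /=; rewrite /with_lab cab.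
by apply: additive_lt => //; rewrite lt_neqAle ax' [(_ <= x)%O]ax.
Qed.

Lemma gr_mul_restrr x a v : supp (below_lab x) v ->
  bilin_ext gr_mul (bvec a) (restr (with_lab x) v) =
  if additive_labels (flab a) x then
    restr (with_lab (flab a `|` x)%O) (bilin_ext (@fmul X) (bvec a) v) else 0.
Proof.
move=> sv; have [add|nadd] := boolP (additive_labels _ _); last first.
  apply: (eq_lin_supp (f := fun v => bilin_ext gr_mul (bvec a) (restr (with_lab x) v))
    (g := fun _ => 0) _ _ sv) => [||b bx].
  - exact: is_lin_comp (bilin_ext_linr _ _) (restr_lin _).
  - exact: is_lin0.
  rewrite restr_bvec; case: ifPn => [/eqP bx'|_]; last exact: (lin0 (bilin_ext_linr _ _)).
  by rewrite bilin_ext_bvec /gr_mul bx' (negPf nadd).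
apply: (eq_lin_supp (f := fun v => bilin_ext gr_mul (bvec a) (restr (with_lab x) v))
  (g := fun v => restr (with_lab (flab a `|` x)%O) (bilin_ext (@fmul X) (bvec a) v))
  _ _ sv) => [||b bx].
- exact: is_lin_comp (bilin_ext_linr _ _) (restr_lin _).
- exact: is_lin_comp (restr_lin _) (bilin_ext_linr _ _).
rewrite restr_bvec bilin_ext_bvec; case: ifPn => [/eqP bx'|bx'].
  by rewrite bilin_ext_bvec /gr_mul bx' add restr_id // -bx'; exact: fmul_lab.
rewrite (lin0 (bilin_ext_linr _ _)) restr_eq0 //.
apply: (sub_supp (fmul_lab a b)) => c /eqP cab /=; rewrite /with_lab cab.
rewrite joinC (joinC _ x); apply: additive_lt; first by rewrite lt_neqAle bx' [(_ <= x)%O]bx.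
by rewrite additiveC.
Qed.

Lemma gr_mul_labl x b v : supp (with_lab x) v ->
  bilin_ext gr_mul v (bvec b) =
  if additive_labels x (flab b) then bilin_ext (@fmul X) v (bvec b) else 0.
Proof.
move=> sv; rewrite -{1}(restr_id sv) gr_mul_restrl; last exact: with_lab_below.
case: ifP => // _; rewrite restr_id //.
apply: (supp_bilin_ext sv (supp_bvec (Q := pred1 b) _)) => //= a c /eqP <- /eqP ->.
exact: fmul_lab.
Qed.

Lemma gr_mul_labr x a v : supp (with_lab x) v ->
  bilin_ext gr_mul (bvec a) v =
  if additive_labels (flab a) x then bilin_ext (@fmul X) (bvec a) v else 0.
Proof.
move=> sv; rewrite -{1}(restr_id sv) gr_mul_restrr; last exact: with_lab_below.
case: ifP => // _; rewrite restr_id //.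
apply: (supp_bilin_ext (supp_bvec (Q := pred1 a) _) sv) => //= c b /eqP -> /eqP <-.
exact: fmul_lab.
Qed.

Lemma gr_mulA a b c :
  bilin_ext gr_mul (bvec a) (gr_mul b c) = bilin_ext gr_mul (gr_mul a b) (bvec c).
Proof.
have -> : bilin_ext gr_mul (bvec a) (gr_mul b c) =
    if additive_labels (flab b) (flab c)
       && additive_labels (flab a) (flab b `|` flab c)%O
    then bilin_ext (@fmul X) (bvec a) (fmul b c) else 0.
  rewrite [in LHS]/gr_mul; case: ifP => _ /=; last exact: (lin0 (bilin_ext_linr _ _)).
  by rewrite (gr_mul_labr _ (fmul_lab b c)).
have -> : bilin_ext gr_mul (gr_mul a b) (bvec c) =
    if additive_labels (flab a) (flab b)
       && additive_labels (flab a `|` flab b)%O (flab c)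
    then bilin_ext (@fmul X) (fmul a b) (bvec c) else 0.
  rewrite [in LHS]/gr_mul; case: ifP => _ /=; last exact: (lin0 (bilin_ext_linl _ _)).
  by rewrite (gr_mul_labl _ (fmul_lab a b)).
(* By subadditivity, both conditions say that the codimension of the triple join is the sum of the
   three codimensions. *)
rewrite (fmulA XP); congr (if _ then _ else _).
rewrite /additive_labels joinA.
have := cdimU cdP (flab a) (flab b); have := cdimU cdP (flab b) (flab c).
have := cdimU cdP (flab a `|` flab b)%O (flab c).
have := cdimU cdP (flab a) (flab b `|` flab c)%O; rewrite joinA; lia.
Qed.

Lemma gr_leibniz a b : lin_ext gr_diff (gr_mul a b) =
  bilin_ext gr_mul (gr_diff a) (bvec b)
  + (-1) ^+ fsz a *: bilin_ext gr_mul (bvec a) (gr_diff b).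
Proof.
have dl e : supp (below_lab (flab e)) (fdiff e).
  by apply: (sub_supp (fdiff_supp XP e)) => c /andP[].
rewrite (gr_mul_restrl _ (dl a)) (gr_mul_restrr _ (dl b)) /gr_mul.
case: ifP => _; last by rewrite (lin0 (lin_ext_lin _)) scaler0 addr0.
rewrite (lin_ext_gr_diff_lab (fmul_lab a b)) (fleibniz XP).
by rewrite (linD (restr_lin _)) (linZ (restr_lin _)).
Qed.

Lemma gr_is_dga : is_dga gr.
Proof.
have suppE n v : basis_homog gr_deg n v <-> supp (fun b => gr_deg b == n) v.
  by split=> H b /H/eqP.
split.
- by move=> n; apply/suppE; exact: supp0.
- move=> n c x y /suppE sx /suppE sy; apply/suppE.
  by rewrite addrC; exact: suppP.
- exact: basis_homog_decomp.
- exact: basis_homog_direct.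
- by move=> c x y z; exact: bilin_ext_linl.
- by move=> c x y z; exact: bilin_ext_linr.
- move=> x y z /=.
  apply: (eq_lin (f := fun x => bilin_ext gr_mul x (bilin_ext gr_mul y z))
    (g := fun x => bilin_ext gr_mul (bilin_ext gr_mul x y) z)) => [||a].
  + exact: bilin_ext_linl.
  + exact: is_lin_comp (bilin_ext_linl _ _) (bilin_ext_linl _ _).
  apply: (eq_lin (f := fun y => bilin_ext gr_mul (bvec a) (bilin_ext gr_mul y z))
    (g := fun y => bilin_ext gr_mul (bilin_ext gr_mul (bvec a) y) z)) => [||b].
  + exact: is_lin_comp (bilin_ext_linr _ _) (bilin_ext_linl _ _).
  + exact: is_lin_comp (bilin_ext_linl _ _) (bilin_ext_linr _ _).
  apply: (eq_lin (f := fun z => bilin_ext gr_mul (bvec a) (bilin_ext gr_mul (bvec b) z))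
    (g := fun z => bilin_ext gr_mul (bilin_ext gr_mul (bvec a) (bvec b)) z)) => [||c].
  + exact: is_lin_comp (bilin_ext_linr _ _) (bilin_ext_linr _ _).
  + exact: bilin_ext_linr.
  by rewrite !bilin_ext_bvec; exact: gr_mulA.
- move=> x /=; apply: (eq_lin (f := bilin_ext gr_mul (bvec (fone X))) (g := id)) => //.
    exact: bilin_ext_linr.
  move=> b; rewrite bilin_ext_bvec /gr_mul /additive_labels (flab1 XP) join0x.
  by rewrite (cdim0 cdP) eqxx (fmul1l XP).
- move=> x /=; apply: (eq_lin (f := fun x => bilin_ext gr_mul x (bvec (fone X))) (g := id)) => //.
    exact: bilin_ext_linl.
  move=> b; rewrite bilin_ext_bvec /gr_mul /additive_labels (flab1 XP) joinx0.
  by rewrite (cdim0 cdP) addn0 eqxx (fmul1r XP).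
- apply/suppE; apply: supp_bvec.
  by rewrite /gr_deg (flab1 XP) (fsz1 XP) (cdim0 cdP).
- move=> m n x y /suppE sx /suppE sy; apply/suppE.
  apply: (supp_bilin_ext sx sy) => a b /eqP <- /eqP <-; rewrite /gr_mul.
  case: ifP => [/eqP add|_]; last exact: supp0.
  apply: (sub_supp (fmul_supp XP a b)) => c /andP[/eqP cl /eqP cs].
  by rewrite /gr_deg cl cs -add; lia.
- by move=> c x y; exact: lin_ext_lin.
- move=> n x /suppE sx; apply/suppE; apply: (supp_lin_ext sx) => b /eqP <-.
  apply: (sub_supp (supp_restr (fdiff_supp XP b))) => c /and3P[/eqP cl _ /eqP cs].
  by rewrite /gr_deg cl -cs; lia.
- move=> x /=; apply: (eq_lin (f := fun x => lin_ext gr_diff (lin_ext gr_diff x))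
    (g := fun _ => 0)) => [||b].
  + exact: is_lin_comp (lin_ext_lin _) (lin_ext_lin _).
  + exact: is_lin0.
  rewrite lin_ext_bvec lin_ext_gr_diff; last first.
    by apply: (sub_supp (fdiff_supp XP b)) => c /andP[].
  by rewrite (fdiffK XP) (lin0 (restr_lin _)).
- move=> n x y /suppE sx /=.
  apply: (eq_lin_supp (f := fun x => lin_ext gr_diff (bilin_ext gr_mul x y))
    (g := fun x => bilin_ext gr_mul (lin_ext gr_diff x) y
           + (-1) ^ n *: bilin_ext gr_mul x (lin_ext gr_diff y)) _ _ sx) => [||a /eqP <-].
  + exact: is_lin_comp (lin_ext_lin _) (bilin_ext_linl _ _).
  + apply: is_linD; last exact: is_linZ (bilin_ext_linl _ _).
    exact: is_lin_comp (bilin_ext_linl _ _) (lin_ext_lin _).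
  apply: (eq_lin (f := fun y => lin_ext gr_diff (bilin_ext gr_mul (bvec a) y))
    (g := fun y => bilin_ext gr_mul (lin_ext gr_diff (bvec a)) y
     + (-1) ^ gr_deg a *: bilin_ext gr_mul (bvec a) (lin_ext gr_diff y))) => [||b].
  + exact: is_lin_comp (lin_ext_lin _) (bilin_ext_linr _ _).
  + apply: is_linD; first exact: bilin_ext_linr.
    by apply: is_linZ; exact: is_lin_comp (bilin_ext_linr _ _) (lin_ext_lin _).
  by rewrite bilin_ext_bvec !lin_ext_bvec gr_deg_sign gr_leibniz.
Qed.

End Graded.
End Filtered.

Arguments fdiff_supp [disp L X] _ b.
Arguments fmul_supp [disp L X] _ a b.

(** * Acyclicity of filtered complexes *)

Section FilteredComplex.
Variables (disp : Order.disp_t) (L : finPOrderType disp) (M : lmodType rat).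
Implicit Types (P Q : {set L}) (A B : L).
(** [pr P] projects to the labels in [P]. It is kept abstract because the complex to which this
    applies is a mapping cone, a product of two free modules. *)
Variables (pr : {set L} -> M -> M) (d : M -> M).
Hypothesis pr_lin : forall P, is_lin (pr P).
Hypothesis prI : forall P Q x, pr P (pr Q x) = pr (P :&: Q) x.
Hypothesis prT : forall x, pr setT x = x.
Hypothesis prC : forall P x, pr P x + pr (~: P) x = x.
Hypothesis d_lin : is_lin d.
Hypothesis dK : forall x, d (d x) = 0.

Definition down_closed (P : {set L}) := forall x y, (x <= y)%O -> y \in P -> x \in P.

Hypothesis d_down : forall P x, down_closed P -> pr P x = x -> pr P (d x) = d x.

Let pr0 x : pr set0 x = 0.
Proof.
by have := prC setT x; rewrite prT setCT => /(congr1 (fun y => - x + y)); rewrite addKr addNr.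
Qed.

Let pr_sub P Q x : P \subset Q -> pr P x = x -> pr Q x = x.
Proof. by move=> PQ <-; rewrite prI (setIidPr PQ). Qed.

Let pr_disj P Q x : P :&: Q = set0 -> pr Q x = x -> pr P x = 0.
Proof. by move=> PQ <-; rewrite prI PQ. Qed.

Let pr_split P A x : pr P x = x -> pr (P :\ A) (x - pr [set A] x) = x - pr [set A] x.
Proof.
move=> Px; have -> : x - pr [set A] x = pr (~: [set A]) x.
  by rewrite -{1}(prC [set A] x) addrAC subrr add0r.
by rewrite prI setDE -setIA setIid -prI -[in RHS]Px !prI setIC.
Qed.

Let down_le A : down_closed [set x | (x <= A)%O].
Proof. by move=> x y xy; rewrite !inE; exact: le_trans. Qed.

Let down_lt A : down_closed [set x | (x < A)%O].
Proof. by move=> x y xy; rewrite !inE; exact: le_lt_trans. Qed.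

Definition acyclic_on P := forall z, pr P z = z -> d z = 0 ->
  exists2 w, pr P w = w & d w = z.

Definition gr_acyclic A := forall z, pr [set A] z = z -> pr [set A] (d z) = 0 ->
  exists2 w, pr [set A] w = w & pr [set A] (d w) = z.

Let exists_max (P : {set L}) : P != set0 ->
  exists2 A, A \in P & forall B, B \in P -> ~~ (A < B)%O.
Proof.
case/set0Pn => A0 A0P.
case: (arg_maxnP (fun A => #|[set x | (x <= A)%O]|) A0P) => A AP Amax.
exists A => // B BP; apply/negP => AB; have := Amax B BP; apply/negP.
rewrite -ltnNge; apply: proper_card; apply/properP; split.
  by apply/subsetP => x; rewrite !inE => /le_trans; apply; exact: ltW.
by exists B; rewrite inE ?lexx ?(lt_geF AB).
Qed.

(** A maximal label [A] is peeled off: a boundary corrects the cycle so that its component at [A]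
    vanishes, and the rest lives on the smaller down-closed set. *)
Let acyclic_of_gr P : down_closed P -> (forall A, A \in P -> gr_acyclic A) ->
  acyclic_on P.
Proof.
elim: {P}#|P| {-2}P (leqnn #|P|) => [|k IHk] P.
  rewrite leqn0 cards_eq0 => /eqP -> _ _ z; rewrite pr0 => <- _.
  by exists 0; [rewrite pr0 | rewrite (lin0 d_lin)].
move=> Pk Pdown Pgr z Pz dz0.
have [P0|/exists_max[A AP Amax]] := eqVneq P set0.
  by move: Pz; rewrite P0 pr0 => <-; exists 0; [rewrite pr0 | rewrite (lin0 d_lin)].
have downD : down_closed (P :\ A).
  move=> x y xy; rewrite !inE => /andP[yA yP]; rewrite (Pdown _ _ xy yP) andbT.
  apply: contraNneq yA => xA; rewrite eq_sym; apply/negPn/negP => Ay.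
  by have := Amax y yP; rewrite lt_neqAle Ay -xA xy.
have disj : [set A] :&: (P :\ A) = set0.
  by apply/setP => x; rewrite !inE; case: eqP.
(* The other components of [z] have labels in the down-closed set [P :\ A], which their differential
   cannot leave. *)
have zA : pr [set A] (d (pr [set A] z)) = 0.
  have -> : pr [set A] z = z - (z - pr [set A] z) by rewrite opprB addrC subrK.
  rewrite (linB d_lin) dz0 sub0r (linN (pr_lin _)).
  by rewrite (pr_disj disj (d_down downD (pr_split A Pz))) oppr0.
have [w wA dw] := Pgr A AP (pr [set A] z) (etrans (prI _ _ _) (congr1 (pr^~ z) (setIid _))) zA.
have wP : pr P w = w by apply: pr_sub wA; rewrite sub1set.
have Pzw : pr P (z - d w) = z - d w by rewrite (linB (pr_lin _)) Pz d_down.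
have := pr_split A Pzw; rewrite (linB (pr_lin [set A])) dw subrr subr0 => Dzw.
have [|B||w' w'P dw'] := IHk (P :\ A) _ downD _ (z - d w) Dzw.
- by rewrite -ltnS (leq_trans _ Pk) // [X in (_ < X)%N](cardsD1 A) AP.
- by rewrite inE => /andP[_]; exact: Pgr.
- by rewrite (linB d_lin) dK dz0 subr0.
exists (w + w'); last by rewrite (linD d_lin) dw' addrC subrK.
by rewrite (linD (pr_lin _)) wP (pr_sub _ w'P) ?subD1set.
Qed.

(** The piece at [A] is the quotient of two acyclic complexes. Explicitly, [d z] lies strictly below
    [A] and bounds some [w] there; then [z - w] is a cycle, and the component at [A] of a chain
    bounding it is the answer. *)
Let gr_acyclic_step A : acyclic_on [set x | (x <= A)%O] ->
  acyclic_on [set x | (x < A)%O] -> gr_acyclic A.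
Proof.
move=> le_ac lt_ac z zA dzA.
have zle : pr [set x | (x <= A)%O] z = z.
  by apply: pr_sub zA; rewrite sub1set inE.
have D : [set x | (x <= A)%O] :\ A = [set x | (x < A)%O].
  by apply/setP => x; rewrite !inE lt_neqAle.
have disj : [set A] :&: [set x | (x < A)%O] = set0.
  by apply/setP => x; rewrite !inE; case: eqP => // ->; rewrite ltxx.
have dz : pr [set x | (x < A)%O] (d z) = d z.
  by have := pr_split A (d_down (@down_le A) zle); rewrite dzA subr0 D.
have [w wlt dw] := lt_ac (d z) dz (dK z).
have wle : pr [set x | (x <= A)%O] w = w.
  by apply: pr_sub wlt; apply/subsetP => x; rewrite !inE; exact: ltW.
have [||u ule du] := le_ac (z - w).
- by rewrite (linB (pr_lin _)) zle wle.
- by rewrite (linB d_lin) dw subrr.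
exists (pr [set A] u); first by rewrite prI setIid.
have -> : pr [set A] u = u - (u - pr [set A] u) by rewrite opprB addrC subrK.
have := pr_split A ule; rewrite D => /(d_down (@down_lt A)) dd.
rewrite (linB d_lin) (linB (pr_lin _)) du.
by rewrite (pr_disj disj dd) (linB (pr_lin _)) zA (pr_disj disj wlt) !subr0.
Qed.

(** The induction is on the number of labels below [A]: graded acyclicity at each of them makes the
    part strictly below [A] acyclic. *)
Lemma gr_acyclicP : (forall A, acyclic_on [set x | (x <= A)%O]) ->
  forall A, gr_acyclic A.
Proof.
move=> ac A; have [k] := ubnP #|[set x | (x < A)%O]|.
elim: k A => // k IHk A Ak; apply: gr_acyclic_step => //.
apply: (acyclic_of_gr (@down_lt A)) => B; rewrite inE => BA.
apply: IHk; apply: leq_trans (_ : #|[set x | (x < A)%O]| <= k)%N => //.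
apply: proper_card; apply/properP; split.
  by apply/subsetP => x; rewrite !inE => /lt_trans; apply.
by exists B; rewrite inE ?ltxx.
Qed.

End FilteredComplex.

(** * Label-preserving maps and morphisms of filtered algebras *)

Lemma restr_lin_comm (B B' : finType) (f : freeQ B -> freeQ B') (Q : pred B) (Q' : pred B') v :
  is_lin f -> (forall b, Q b -> supp Q' (f (bvec b))) ->
  (forall b, ~~ Q b -> supp (predC Q') (f (bvec b))) ->
  restr Q' (f v) = f (restr Q v).
Proof.
move=> fl H1 H2.
apply: (eq_lin (f := fun v => restr Q' (f v)) (g := fun v => f (restr Q v))) => [||b].
- exact: is_lin_comp (restr_lin _) fl.
- exact: is_lin_comp fl (restr_lin _).
rewrite restr_bvec; case: ifPn => [/H1|/H2] H; first by rewrite restr_id.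
by rewrite (lin0 fl) restr_eq0.
Qed.

Lemma sum_restr (B : finType) (I : finType) (lab : B -> I) (v : freeQ B) :
  \sum_i restr (fun b => lab b == i) v = v.
Proof.
apply/ffunP => b; rewrite sum_ffunE (bigD1 (lab b)) //= ffunE eqxx big1 ?addr0 //.
by move=> i ib; rewrite ffunE eq_sym (negPf ib).
Qed.

Section Morphism.
Variables (disp : Order.disp_t) (L : bJoinSemilatticeType disp) (cdim : L -> nat).
Variables (X Y : filt_data L) (f : fbase X -> freeQ (fbase Y)).

(** Labels are preserved exactly, so the same linear map serves on the associated graded algebras
    without truncation. *)
Record is_filt_morph : Prop := IsFiltMorph {
  fmor_supp : forall a, supp (fun b => (flab b == flab a) && (fsz b == fsz a)) (f a);
  fmor_one : f (fone X) = bvec (fone Y);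
  fmor_diff : forall a, lin_ext f (fdiff a) = lin_ext (@fdiff _ _ Y) (f a);
  fmor_mul : forall a b, lin_ext f (fmul a b) = bilin_ext (@fmul _ _ Y) (f a) (f b)
}.
Arguments fmor_supp _ a : clear implicits.

Hypothesis cdP : codim_axioms cdim.
Hypothesis XP : is_filt_dga X.
Hypothesis YP : is_filt_dga Y.
Hypothesis fP : is_filt_morph.

Lemma fmor_diff_lin x : lin_ext f (lin_ext (@fdiff _ _ X) x) = lin_ext (@fdiff _ _ Y) (lin_ext f x).
Proof.
apply: (eq_lin (f := fun x => lin_ext f (lin_ext (@fdiff _ _ X) x))
  (g := fun x => lin_ext (@fdiff _ _ Y) (lin_ext f x))) => [||b].
- exact: is_lin_comp (lin_ext_lin _) (lin_ext_lin _).
- exact: is_lin_comp (lin_ext_lin _) (lin_ext_lin _).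
by rewrite !lin_ext_bvec; exact: fmor_diff.
Qed.

Lemma restr_fmor (P : pred L) x :
  restr (fun b => P (flab b)) (lin_ext f x) = lin_ext f (restr (fun b => P (flab b)) x).
Proof.
apply: restr_lin_comm => [|a Pa|a Pa]; first exact: lin_ext_lin.
all: rewrite lin_ext_bvec; apply: (sub_supp (fmor_supp fP a)) => b /andP[/eqP ba _].
all: by rewrite /= ba.
Qed.

Lemma restr_fmor_deg m x :
  restr (fun b => gr_deg cdim b == m) (lin_ext f x)
  = lin_ext f (restr (fun b => gr_deg cdim b == m) x).
Proof.
apply: restr_lin_comm => [|a Pa|a Pa]; first exact: lin_ext_lin.
all: rewrite lin_ext_bvec; apply: (sub_supp (fmor_supp fP a)) => b /andP[/eqP ba /eqP bs].
all: by move: Pa; rewrite /= /gr_deg ba bs.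
Qed.

Lemma gr_morphism : @dga_morphism (gr cdim X) (gr cdim Y) (lin_ext f).
Proof.
split.
- exact: lin_ext_lin.
- move=> m x xm; have := restr_fmor_deg m x.
  rewrite (@restr_id _ _ x) => [<- b|b /xm -> //].
  by rewrite ffunE; case: (gr_deg cdim b =P m) => [-> //|_]; rewrite eqxx.
- move=> x /=.
  apply: (eq_lin (f := fun x => lin_ext f (lin_ext (@gr_diff _ _ X) x))
    (g := fun x => lin_ext (@gr_diff _ _ Y) (lin_ext f x))) => [||a].
  + exact: is_lin_comp (lin_ext_lin _) (lin_ext_lin _).
  + exact: is_lin_comp (lin_ext_lin _) (lin_ext_lin _).
  rewrite !lin_ext_bvec (@lin_ext_gr_diff_lab _ _ _ YP (flab a)); last first.
    by apply: (sub_supp (fmor_supp fP a)) => b /andP[].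
  by rewrite -(fmor_diff fP) /gr_diff -(restr_fmor (fun y => y == flab a)).
- move=> x y /=.
  apply: (eq_lin (f := fun x => lin_ext f (bilin_ext (@gr_mul _ _ cdim X) x y))
    (g := fun x => bilin_ext (@gr_mul _ _ cdim Y) (lin_ext f x) (lin_ext f y))) => [||a].
  + exact: is_lin_comp (lin_ext_lin _) (bilin_ext_linl _ _).
  + exact: is_lin_comp (bilin_ext_linl _ _) (lin_ext_lin _).
  apply: (eq_lin (f := fun y => lin_ext f (bilin_ext (@gr_mul _ _ cdim X) (bvec a) y))
    (g := fun y => bilin_ext (@gr_mul _ _ cdim Y) (lin_ext f (bvec a)) (lin_ext f y))) => [||b].
  + exact: is_lin_comp (lin_ext_lin _) (bilin_ext_linr _ _).
  + exact: is_lin_comp (bilin_ext_linr _ _) (lin_ext_lin _).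
  have fs c : supp (with_lab (flab c)) (f c).
    by apply: (sub_supp (fmor_supp fP c)) => e /andP[].
  rewrite bilin_ext_bvec !lin_ext_bvec.
  have -> : bilin_ext (@gr_mul _ _ cdim Y) (f a) (f b) =
      if additive_labels cdim (flab a) (flab b)
      then bilin_ext (@fmul _ _ Y) (f a) (f b) else 0.
    apply: (eq_lin_supp (f := fun v => bilin_ext (@gr_mul _ _ cdim Y) v (f b))
      (g := fun v => if additive_labels cdim (flab a) (flab b)
        then bilin_ext (@fmul _ _ Y) v (f b) else 0) _ _ (fs a)) => [||c /eqP ca].
    + exact: bilin_ext_linl.
    + case: (additive_labels _ _ _); [exact: bilin_ext_linl | exact: is_lin0].
    by rewrite (gr_mul_labr cdP YP _ (fs b)) ca.
  rewrite /gr_mul; case: ifP => _; last exact: (lin0 (lin_ext_lin _)).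
  exact: fmor_mul.
- by rewrite /= lin_ext_bvec (fmor_one fP).
Qed.

End Morphism.

Arguments fmor_supp [disp L X Y f] _ a.

(** * Contracting homotopies *)

Section Contraction.
Variables (disp : Order.disp_t) (L : bJoinSemilatticeType disp) (X : filt_data L).
Hypothesis XP : is_filt_dga X.

Lemma fdiff_one : fdiff (fone X) = 0.
Proof.
apply/ffunP => b; rewrite ffunE; apply/eqP/negPn/negP.
by move=> /(fdiff_supp XP (fone X)) /andP[_]; rewrite (fsz1 XP).
Qed.

Lemma fdiffK_lin x : lin_ext (@fdiff _ _ X) (lin_ext (@fdiff _ _ X) x) = 0.
Proof.
apply: (eq_lin (f := fun x => lin_ext (@fdiff _ _ X) (lin_ext (@fdiff _ _ X) x))
  (g := fun _ => 0)) => [||b].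
- exact: is_lin_comp (lin_ext_lin _) (lin_ext_lin _).
- exact: is_lin0.
by rewrite lin_ext_bvec (fdiffK XP).
Qed.

Lemma fmulA_lin u v w : bilin_ext (@fmul _ _ X) u (bilin_ext (@fmul _ _ X) v w) =
  bilin_ext (@fmul _ _ X) (bilin_ext (@fmul _ _ X) u v) w.
Proof.
set mul := bilin_ext (@fmul _ _ X).
apply: (eq_lin (f := fun u => mul u (mul v w)) (g := fun u => mul (mul u v) w)) => [||a].
- exact: bilin_ext_linl.
- exact: is_lin_comp (bilin_ext_linl _ _) (bilin_ext_linl _ _).
apply: (eq_lin (f := fun v => mul (bvec a) (mul v w)) (g := fun v => mul (mul (bvec a) v) w)) => [||b].
- exact: is_lin_comp (bilin_ext_linr _ _) (bilin_ext_linl _ _).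
- exact: is_lin_comp (bilin_ext_linl _ _) (bilin_ext_linr _ _).
apply: (eq_lin (f := fun w => mul (bvec a) (mul (bvec b) w)) (g := fun w => mul (mul (bvec a) (bvec b)) w)) => [||c].
- exact: is_lin_comp (bilin_ext_linr _ _) (bilin_ext_linr _ _).
- exact: bilin_ext_linr.
by rewrite /mul !bilin_ext_bvec (fmulA XP).
Qed.

Lemma fmul_anticomm (a b : fbase X) v : fmul a b = - fmul b a ->
  bilin_ext (@fmul _ _ X) (bvec a) (bilin_ext (@fmul _ _ X) (bvec b) v) =
  - bilin_ext (@fmul _ _ X) (bvec b) (bilin_ext (@fmul _ _ X) (bvec a) v).
Proof.
by move=> ab; rewrite !fmulA_lin !bilin_ext_bvec ab (linN (bilin_ext_linl _ _)).
Qed.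

Lemma fmul_square0 (a : fbase X) v : fmul a a = 0 ->
  bilin_ext (@fmul _ _ X) (bvec a) (bilin_ext (@fmul _ _ X) (bvec a) v) = 0.
Proof.
by move=> aa; rewrite fmulA_lin bilin_ext_bvec aa (lin0 (bilin_ext_linl _ _)).
Qed.

Lemma fdiff_mul_primitive (a : fbase X) z : fsz a = 1%N -> fdiff a = - bvec (fone X) ->
  lin_ext (@fdiff _ _ X) (bilin_ext (@fmul _ _ X) (bvec a) z) =
  - z - bilin_ext (@fmul _ _ X) (bvec a) (lin_ext (@fdiff _ _ X) z).
Proof.
move=> sa da; rewrite -(scaleN1r z) -(scaleN1r (bilin_ext _ _ _)).
apply: (eq_lin (f := fun z => lin_ext (@fdiff _ _ X) (bilin_ext (@fmul _ _ X) (bvec a) z))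
  (g := fun z => -1 *: z + -1 *: bilin_ext (@fmul _ _ X) (bvec a) (lin_ext (@fdiff _ _ X) z))) => [||b].
- exact: is_lin_comp (lin_ext_lin _) (bilin_ext_linr _ _).
- apply: is_linD; first by apply: is_linZ => c x1 y1.
  by apply: is_linZ; exact: is_lin_comp (bilin_ext_linr _ _) (lin_ext_lin _).
rewrite bilin_ext_bvec (fleibniz XP) sa da (linN (bilin_ext_linl _ _)).
by rewrite bilin_ext_bvec (fmul1l XP) lin_ext_bvec expr1 !scaleN1r.
Qed.

(* Left multiplication by an element [a] with [d a = - 1] is, up to sign, a
   contracting homotopy. *)
Lemma contraction x (a : fbase X) z :
  (flab a <= x)%O -> fsz a = 1%N -> fdiff a = - bvec (fone X) ->
  supp (below_lab x) z -> lin_ext (@fdiff _ _ X) z = 0 ->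
  exists2 w, supp (below_lab x) w & lin_ext (@fdiff _ _ X) w = z.
Proof.
move=> ax sa da sz dz; exists (- bilin_ext (@fmul _ _ X) (bvec a) z).
  apply: suppN; rewrite bilin_ext_bvecl; apply: (supp_lin_ext sz) => b bx.
  apply: (sub_supp (fmul_supp XP a b)) => c /andP[/eqP cab _].
  by rewrite /below_lab cab leUx ax.
rewrite (linN (lin_ext_lin _)) fdiff_mul_primitive //.
by rewrite dz (lin0 (bilin_ext_linr _ _)) subr0 opprK.
Qed.

End Contraction.

(** * Filtered quasi-isomorphisms over the intersection lattice *)

Section Arrangement.
Variables (K : fieldType) (V : vectType K) (n : nat) (U : 'I_n -> {vspace V}).
Local Notation L := (ilat U).

(** Subadditivity is the dimension formula together with the bound of the sum of subspaces by the
    whole space. *)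
Lemma cd_codim_axioms : codim_axioms (@cd K V n U).
Proof.
split.
- by rewrite /cd /= /inter big_set0 subnn.
- move=> x y; rewrite /cd /=.
  have := dimv_sum_cap (ssval x) (ssval y).
  have := dimvS (subvf (ssval x + ssval y)%VS).
  have := dimvS (subvf (ssval x)); have := dimvS (subvf (ssval y)); lia.
- move=> x y; rewrite lt_def => /andP[yx xy]; rewrite /cd.
  have : (\dim (ssval y) < \dim (ssval x))%N.
    rewrite (ltn_leqif (dimv_leqif_sup xy)); apply: contra yx => xy'.
    by apply/eqP/val_inj/subv_anti; rewrite xy' andbT.
  have := dimvS (subvf (ssval x)); lia.
Qed.

Section QuasiIso.
Variables (X Y : filt_data L) (f : fbase X -> freeQ (fbase Y)).
Hypotheses (XP : is_filt_dga X) (YP : is_filt_dga Y) (fP : is_filt_morph f).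

Definition has_primitives (Z : filt_data L) := forall x : L, x != \bot%O ->
  exists a : fbase Z, [/\ (flab a <= x)%O, fsz a = 1%N & fdiff a = - bvec (fone Z)].

(** Replaces [has_primitives] at the bottom label, where the complex is one-dimensional. *)
Definition connected_base (Z : filt_data L) :=
  forall a : fbase Z, flab a = \bot%O -> a = fone Z.

Hypotheses (Xprim : has_primitives X) (Yprim : has_primitives Y).
Hypotheses (Xconn : connected_base X) (Yconn : connected_base Y).

Local Notation dX := (lin_ext (@fdiff _ _ X)).
Local Notation dY := (lin_ext (@fdiff _ _ Y)).
Local Notation gX := (lin_ext (@gr_diff _ _ X)).
Local Notation gY := (lin_ext (@gr_diff _ _ Y)).
Local Notation F := (lin_ext f).
Local Notation cone := (freeQ (fbase X) * freeQ (fbase Y))%type.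

Definition cone_pr (P : {set L}) (z : cone) : cone :=
  (restr (fun b => flab b \in P) z.1, restr (fun b => flab b \in P) z.2).

Definition cone_diff (z : cone) : cone := (- dX z.1, F z.1 + dY z.2).

Lemma cone_prE P z : cone_pr P z = z <->
  supp (fun b => flab b \in P) z.1 /\ supp (fun b => flab b \in P) z.2.
Proof.
case: z => x y; split=> [[Ex Ey]|[sx sy]] /=; last by rewrite /cone_pr /= !restr_id.
by rewrite -Ex -Ey; split=> b; rewrite ffunE; case: ifP => //; rewrite eqxx.
Qed.

Lemma below_set (Z : filt_data L) (x : L) (v : freeQ (fbase Z)) :
  supp (fun b => flab b \in [set y : L | (y <= x)%O]) v <-> supp (below_lab x) v.
Proof. by split=> sv b /sv; rewrite inE. Qed.

Lemma supp_bot (Z : filt_data L) (v : freeQ (fbase Z)) : connected_base Z ->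
  supp (below_lab \bot%O) v -> v = v (fone Z) *: bvec (fone Z).
Proof.
move=> Zc sv; have /supp_expand : supp (pred1 (fone Z)) v.
  by apply: (sub_supp sv) => b; rewrite /below_lab lex0 => /eqP/Zc/eqP.
by rewrite big_pred1_eq.
Qed.

Lemma cone_acyclic (x : L) : acyclic_on cone_pr cone_diff [set y : L | (y <= x)%O].
Proof.
move=> [u v] /cone_prE[/= /below_set su /below_set sv] [du dv].
have {du}du : dX u = 0 by apply/eqP; rewrite -oppr_eq0 du.
have [x0|x0] := eqVneq x \bot%O.
  rewrite x0 in su sv *.
  have d1 (Z : filt_data L) (w : freeQ (fbase Z)) : is_filt_dga Z -> connected_base Z ->
      supp (below_lab \bot%O) w -> lin_ext (@fdiff _ _ Z) w = 0.
    move=> ZP Zc /(supp_bot Zc) ->.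
    by rewrite (linZ (lin_ext_lin _)) lin_ext_bvec (fdiff_one ZP) scaler0.
  have u0 : u = 0.
    move: dv; rewrite (d1 _ v) // addr0 (supp_bot Xconn su).
    rewrite (linZ (lin_ext_lin _)) lin_ext_bvec (fmor_one fP) => /eqP.
    rewrite scaler_eq0 => /orP[/eqP ->|/eqP/ffunP/(_ (fone Y))]; first by rewrite scale0r.
    by rewrite !ffunE eqxx => /eqP; rewrite oner_eq0.
  have sw : supp (below_lab \bot%O) (v (fone Y) *: bvec (fone X)).
    by apply/suppZ/supp_bvec; rewrite /below_lab (flab1 XP).
  (* At the bottom [F] is an isomorphism between lines spanned by the units; the witness is the
     preimage of [v]. *)
  exists (v (fone Y) *: bvec (fone X), 0).
    by apply/cone_prE; split; apply/below_set => //; exact: supp0.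
  rewrite /cone_diff /= (d1 _ _ XP Xconn sw) oppr0 u0; congr (_, _).
  rewrite (lin0 (lin_ext_lin _)) addr0 (linZ (lin_ext_lin _)) lin_ext_bvec.
  by rewrite (fmor_one fP) -(supp_bot Yconn sv).
have [a [ax sa da]] := Xprim x0; have [b [bx sb db]] := Yprim x0.
(* [p] bounds [u], which turns [v + F p] into a cycle; [q] bounds it, and [(- p, q)] bounds [(u, v)]
   in the cone. *)
have [p sp dp] := contraction XP ax sa da su du.
have Fp : supp (below_lab x) (F p).
  apply: (supp_lin_ext sp) => c cx; apply: (sub_supp (fmor_supp fP c)) => e /andP[/eqP ec _].
  by rewrite /below_lab ec.
have [||q sq dq] := contraction YP bx sb db (z := v + F p).
- exact: suppD.
- by rewrite (linD (lin_ext_lin _)) -(fmor_diff_lin fP) dp addrC.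
exists (- p, q).
  by apply/cone_prE; split; apply/below_set => //; exact: suppN.
rewrite /cone_diff /= !(linN (lin_ext_lin _)) opprK dp dq; congr (_, _).
by rewrite addrC addrK.
Qed.

Lemma cone_gr_acyclic (x : L) : gr_acyclic cone_pr cone_diff x.
Proof.
apply: gr_acyclicP => //.
- by move=> P c [u v] [u' v']; rewrite /cone_pr /= !restr_lin.
- move=> P Q [u v]; congr (_, _); apply/ffunP => b; rewrite !ffunE !inE;
    by case: (_ \in P).
- by move=> [u v]; congr (_, _); apply/ffunP => b; rewrite !ffunE !inE.
- by move=> P [u v]; congr (_, _); apply/ffunP => b; rewrite !ffunE !inE;
    case: (_ \in P); rewrite ?addr0 ?add0r.
- move=> c [u v] [u' v']; rewrite /cone_diff /=.
  rewrite !(linD (lin_ext_lin _)) !(linZ (lin_ext_lin _)); congr (_, _).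
    by rewrite /= opprD scalerN.
  by rewrite /= scalerDr addrACA.
- move=> [u v]; rewrite /cone_diff /= !(linN (lin_ext_lin _)).
  rewrite (fdiffK_lin XP) (linD (lin_ext_lin _)) (fmor_diff_lin fP) (fdiffK_lin YP).
  by rewrite addr0 addNr !oppr0.
- move=> P [u v] Pdown /cone_prE[/= su sv]; apply/cone_prE; split=> /=.
    apply: suppN; apply: (supp_lin_ext su) => b bP.
    by apply: (sub_supp (fdiff_supp XP b)) => c /andP[/Pdown] /(_ bP).
  apply: suppD.
    apply: (supp_lin_ext su) => b bP.
    by apply: (sub_supp (fmor_supp fP b)) => c /andP[/eqP ->].
  apply: (supp_lin_ext sv) => b bP.
  by apply: (sub_supp (fdiff_supp YP b)) => c /andP[/Pdown] /(_ bP).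
- exact: cone_acyclic.
Qed.

Lemma restr_set1 (Z : filt_data L) (x : L) (v : freeQ (fbase Z)) :
  restr (fun b => flab b \in [set (x : L)]) v = restr (with_lab x) v.
Proof. by apply/ffunP => b; rewrite !ffunE inE. Qed.

Lemma restr_gr_diff (Z : filt_data L) (x : L) (v : freeQ (fbase Z)) : is_filt_dga Z ->
  restr (with_lab x) (lin_ext (@gr_diff _ _ Z) v)
  = lin_ext (@gr_diff _ _ Z) (restr (with_lab x) v).
Proof.
move=> ZP; apply: restr_lin_comm => [|a ax|a ax]; first exact: lin_ext_lin.
all: rewrite lin_ext_bvec; apply: (sub_supp (supp_restr (fdiff_supp ZP a))).
all: by move=> b /andP[/eqP ba _]; rewrite /= /with_lab ba.
Qed.

(* Acyclicity of the mapping cone of the map of associated graded complexes. *)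
Lemma gr_cone_exact u v : gX u = 0 -> F u + gY v = 0 ->
  exists p q, - gX p = u /\ F p + gY q = v.
Proof.
move=> du dv.
(* A bounding pair is chosen for each label. [F] and the graded differentials preserve labels, so
   the sum of these pairs bounds [(u, v)]. *)
have [|w H] := @fin_all_exists L (fun _ => cone) (fun x w =>
    [/\ supp (with_lab x) w.1, supp (with_lab x) w.2,
        - gX w.1 = restr (with_lab x) u & F w.1 + gY w.2 = restr (with_lab x) v]).
  move=> x; set ux := restr (with_lab x) u; set vx := restr (with_lab x) v.
  have sl (Z : filt_data L) (t : freeQ (fbase Z)) : supp (with_lab x) (restr (with_lab x) t).
    by apply: (sub_supp (supp_restr (@suppT _ t))) => b /andP[].
  have F_lab t : supp (with_lab x) t -> restr (with_lab x) (F t) = F t.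
    by move=> st; rewrite (restr_fmor fP (fun y => y == x)) restr_id.
  have [||[p q] /cone_prE[/= sp sq]] := @cone_gr_acyclic x (ux, vx).
  - by apply/cone_prE; split=> /= b /sl; rewrite inE.
  - rewrite /cone_pr /= !restr_set1 (linN (restr_lin _)) (linD (restr_lin _)).
    rewrite -(lin_ext_gr_diff_lab XP (sl _ u)) -(lin_ext_gr_diff_lab YP (sl _ v)).
    rewrite -!restr_gr_diff // du.
    rewrite (lin0 (restr_lin _)) oppr0 (F_lab _ (sl _ u)).
    by rewrite -(restr_fmor fP (fun y => y == x)) -(linD (restr_lin _)) dv (lin0 (restr_lin _)).
  have {}sp : supp (with_lab x) p by move=> b /sp; rewrite inE.
  have {}sq : supp (with_lab x) q by move=> b /sq; rewrite inE.
  rewrite /cone_pr /= !restr_set1 (linN (restr_lin _)) (linD (restr_lin _)) => -[E1 E2].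
  exists (p, q); split=> //=.
    by rewrite (lin_ext_gr_diff_lab XP sp).
  by rewrite (lin_ext_gr_diff_lab YP sq) -(F_lab _ sp).
exists (\sum_x (w x).1), (\sum_x (w x).2); split.
  rewrite (lin_sum (lin_ext_lin _)) -sumrN -[RHS](sum_restr (@flab _ _ X)).
  by apply: eq_bigr => x _; case: (H x).
rewrite !(lin_sum (lin_ext_lin _)) -big_split /= -[RHS](sum_restr (@flab _ _ Y)).
by apply: eq_bigr => x _; case: (H x).
Qed.

Lemma restr_gr_diff_deg (Z : filt_data L) (m : int) (v : freeQ (fbase Z)) : is_filt_dga Z ->
  restr (fun b => gr_deg (@cd K V n U) b == m + 1) (lin_ext (@gr_diff _ _ Z) v)
  = lin_ext (@gr_diff _ _ Z) (restr (fun b => gr_deg (@cd K V n U) b == m) v).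
Proof.
move=> ZP; apply: restr_lin_comm => [|a am|a am]; first exact: lin_ext_lin.
all: rewrite lin_ext_bvec; apply: (sub_supp (supp_restr (fdiff_supp ZP a))).
all: move=> b /and3P[/eqP ba _ /eqP bs]; move: am; rewrite /= /gr_deg ba -bs.
all: by rewrite -[(fsz b).+1]addn1 PoszD opprD addrA -(subr_eq _ _ 1).
Qed.

Lemma homog_restr (Z : filt_data L) (m : int) (v : freeQ (fbase Z)) :
  basis_homog (gr_deg (@cd K V n U) (X := Z)) m (restr (fun b => gr_deg (@cd K V n U) b == m) v).
Proof. by move=> b; rewrite ffunE; case: (_ =P m) => [-> //|_]; rewrite eqxx. Qed.

Lemma restr_homog (Z : filt_data L) (m : int) (v : freeQ (fbase Z)) :
  basis_homog (gr_deg (@cd K V n U) (X := Z)) m v ->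
  restr (fun b => gr_deg (@cd K V n U) b == m) v = v.
Proof. by move=> vm; apply: restr_id => b /vm ->. Qed.

(** The cone cycle [(x - y, - w)] gives injectivity and [(0, z)] gives surjectivity. *)
Lemma gr_cohomology_iso :
  @cohomology_iso (gr (@cd K V n U) X) (gr (@cd K V n U) Y) (lin_ext f).
Proof.
have fl := lin_ext_lin f; move=> m; split.
  move=> x y [xm dx] [ym dy] [w [wm E]] /=; rewrite /= in dx dy E.
  have [||p [q [Ep Eq]]] := @gr_cone_exact (x - y) (- w).
  - by rewrite (linB (lin_ext_lin _)) dx dy subr0.
  - by rewrite (linB fl) E (linN (lin_ext_lin _)) subrr.
  (* [gr_cone_exact] ignores degrees, so the homogeneous part of the right degree is extracted; the
     differential maps it to the part one degree higher. *)
  exists (- restr (fun b => gr_deg (@cd K V n U) b == m - 1) p); split.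
    by move=> b; rewrite ffunE oppr_eq0; exact: homog_restr.
  rewrite /= (linN (lin_ext_lin _)) -restr_gr_diff_deg // -(linN (restr_lin _)) Ep subrK.
  by rewrite (linB (restr_lin _)) !restr_homog.
move=> z [zm dz]; rewrite /= in dz.
have [||p [q [Ep Eq]]] := @gr_cone_exact 0 z.
- exact: (lin0 (lin_ext_lin _)).
- by rewrite (lin0 fl) add0r.
have {}Ep : gX p = 0 by apply/eqP; rewrite -oppr_eq0 Ep.
exists (restr (fun b => gr_deg (@cd K V n U) b == m) p); split.
  split; first exact: homog_restr.
  by rewrite /= -restr_gr_diff_deg // Ep (lin0 (restr_lin _)).
exists (- restr (fun b => gr_deg (@cd K V n U) b == m - 1) q); split.
  by move=> b; rewrite ffunE oppr_eq0; exact: homog_restr.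
rewrite /= (linN (lin_ext_lin _)) -restr_gr_diff_deg // subrK.
rewrite -(restr_fmor_deg _ fP) -{1}(restr_homog zm) -Eq (linD (restr_lin _)).
by rewrite opprD addrA subrr add0r.
Qed.

End QuasiIso.
End Arrangement.

(** * The exterior algebra on the atoms *)

Section Exterior.
Variable n : nat.
Implicit Types (s t u : {set 'I_n}) (i j k : 'I_n).

Definition below t i : nat := (\sum_(j in t) (j < i))%N.
(** The number of inversions when [s] is written before [t]. *)
Definition inv2 s t : nat := (\sum_(i in s) below t i)%N.

Lemma sum_setU_disjoint (F : 'I_n -> nat) s t : [disjoint s & t] ->
  (\sum_(i in s :|: t) F i = \sum_(i in s) F i + \sum_(i in t) F i)%N.
Proof.
by move=> st; rewrite -bigU //; apply: eq_bigl => i; rewrite !inE.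
Qed.

Lemma belowU s t i : [disjoint s & t] -> below (s :|: t) i = (below s i + below t i)%N.
Proof. exact: sum_setU_disjoint. Qed.

Lemma inv2Ul s t u : [disjoint s & t] -> inv2 (s :|: t) u = (inv2 s u + inv2 t u)%N.
Proof. exact: sum_setU_disjoint. Qed.

Lemma inv2Ur s t u : [disjoint t & u] -> inv2 s (t :|: u) = (inv2 s t + inv2 s u)%N.
Proof.
move=> tu; rewrite /inv2 -big_split /=; apply: eq_bigr => i _; exact: belowU.
Qed.

Lemma inv2_1 i t : inv2 [set i] t = below t i.
Proof. by rewrite /inv2 big_set1. Qed.

Lemma below_setU1 i t k : i \notin t -> below (i |: t) k = ((i < k) + below t k)%N.
Proof. by move=> it; rewrite /below big_setU1. Qed.

Lemma below_setD1 i t k : i \in t -> below t k = ((i < k) + below (t :\ i) k)%N.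
Proof. by move=> it; rewrite /below (big_setD1 i). Qed.

Lemma card_leq_below s i : i \in s -> #|[set k in s | (k <= i)%N]| = (below s i).+1.
Proof.
move=> si; rewrite (below_setD1 _ si) ltnn add0n -sum1dep_card (bigD1 i) ?si ?leqnn //=.
rewrite add1n; congr _.+1; rewrite /below big_mkcond [RHS]big_mkcond /=.
apply: eq_bigr => k _; rewrite !inE -val_eqE ltn_neqAle.
by case: (k \in s); case: (_ == _); case: (_ <= _)%N.
Qed.

Lemma disjoint_setUl s t u :
  [disjoint s :|: t & u] = [disjoint s & u] && [disjoint t & u].
Proof. by rewrite !disjoints_subset subUset. Qed.

Definition ext_mul s t : freeQ {set 'I_n} :=
  if [disjoint s & t] then (-1) ^+ inv2 s t *: bvec (s :|: t) else 0.

Definition ext_diff s : freeQ {set 'I_n} :=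
  \sum_(i in s) (-1) ^+ (below s i).+1 *: bvec (s :\ i).

Local Notation mul := (bilin_ext ext_mul).
Local Notation diff := (lin_ext ext_diff).

Lemma ext_mulA s t u : mul (bvec s) (ext_mul t u) = mul (ext_mul s t) (bvec u).
Proof.
rewrite /ext_mul; have [tu|tu] := boolP [disjoint t & u]; last first.
  rewrite (lin0 (bilin_ext_linr _ _)); case: ifP => _; last by rewrite (lin0 (bilin_ext_linl _ _)).
  rewrite (linZ (bilin_ext_linl _ _)) bilin_ext_bvec ifF ?scaler0 //.
  by apply/negbTE; apply: contra tu; apply: disjointWl; exact: subsetUr.
rewrite (linZ (bilin_ext_linr _ _)) bilin_ext_bvec.
have [st|st] := boolP [disjoint s & t]; last first.
  rewrite (lin0 (bilin_ext_linl _ _)) ifF ?scaler0 //.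
  by apply/negbTE; apply: contra st; apply: disjointWr; exact: subsetUl.
rewrite (linZ (bilin_ext_linl _ _)) bilin_ext_bvec.
rewrite ![[disjoint s & _]]disjoint_sym !disjoint_setUl disjoint_sym st tu !andbT.
rewrite [[disjoint u & s]]disjoint_sym /=; case: (boolP [disjoint s & u]) => su; rewrite ?scaler0 //.
by rewrite !scalerA -!exprD setUA inv2Ur // inv2Ul //; congr (_ ^+ _ *: _); lia.
Qed.

Lemma ext_mulA_lin (u v w : freeQ {set 'I_n}) : mul u (mul v w) = mul (mul u v) w.
Proof.
apply: (eq_lin (f := fun x => mul x (mul v w)) (g := fun x => mul (mul x v) w)) => [||a].
- exact: bilin_ext_linl.
- exact: is_lin_comp (bilin_ext_linl _ _) (bilin_ext_linl _ _).
apply: (eq_lin (f := fun v => mul (bvec a) (mul v w)) (g := fun v => mul (mul (bvec a) v) w)) => [||b].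
- exact: is_lin_comp (bilin_ext_linr _ _) (bilin_ext_linl _ _).
- exact: is_lin_comp (bilin_ext_linl _ _) (bilin_ext_linr _ _).
apply: (eq_lin (f := fun w => mul (bvec a) (mul (bvec b) w)) (g := fun w => mul (mul (bvec a) (bvec b)) w)) => [||c].
- exact: is_lin_comp (bilin_ext_linr _ _) (bilin_ext_linr _ _).
- exact: bilin_ext_linr.
by rewrite !bilin_ext_bvec ext_mulA.
Qed.

Lemma ext_mul0l t : ext_mul set0 t = bvec t.
Proof.
by rewrite /ext_mul -setI_eq0 set0I eqxx set0U /inv2 big_set0 scale1r.
Qed.

Lemma ext_mul0r t : ext_mul t set0 = bvec t.
Proof.
rewrite /ext_mul -setI_eq0 setI0 eqxx setU0 /inv2 big1 ?scale1r // => i _.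
by rewrite /below big_set0.
Qed.

Lemma ext_mul1 i t :
  ext_mul [set i] t = if i \in t then 0 else (-1) ^+ below t i *: bvec (i |: t).
Proof. by rewrite /ext_mul disjoints1 inv2_1; case: (i \in t). Qed.

Lemma ext_mul_min i t : (forall j, j \in t -> (i < j)%N) ->
  ext_mul [set i] t = bvec (i |: t).
Proof.
move=> it; rewrite ext_mul1 ifF; last by apply/negbTE/negP => /it; rewrite ltnn.
by rewrite /below big1 ?scale1r // => j /it; case: ltngtP.
Qed.

(** A new least element is multiplied on the left without a sign ([ext_mul_min]), so identities
    reduce to left multiplication by one generator. *)
Lemma ext_ind (P : {set 'I_n} -> Prop) : P set0 ->
  (forall i t, (forall j, j \in t -> (i < j)%N) -> P t -> P (i |: t)) ->
  forall s, P s.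
Proof.
move=> P0 PS s; have [k] := ubnP #|s|; elim: k s => // k IHk s sk.
have [-> //|/set0Pn[i0 i0s]] := eqVneq s set0.
case: (arg_minnP (fun i : 'I_n => (i : nat)) i0s) => i si imin.
have {}si : i \in s by exact: si.
rewrite -(setD1K si); apply: PS => [j|].
  by rewrite !inE ltn_neqAle => /andP[ji /imin ->]; rewrite eq_sym ji.
by apply: IHk; rewrite (cardsD1 i) si in sk.
Qed.

Lemma ext_diff_mul1 i t : diff (ext_mul [set i] t) =
  - bvec t - mul (bvec [set i]) (ext_diff t).
Proof.
rewrite ext_mul1 [ext_diff t]/ext_diff (lin_sum (bilin_ext_linr _ _)).
have [it|it] := boolP (i \in t).
  (* The product vanishes, and the only face of [t] not killed by [i] is the one without [i];
     multiplied by [i], it cancels [t]. *)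
  rewrite (lin0 (lin_ext_lin _)) (bigD1 i) //= big1 => [|k /andP[kt ki]]; last first.
    rewrite (linZ (bilin_ext_linr _ _)) bilin_ext_bvec ext_mul1 !inE eq_sym ki it.
    by rewrite scaler0.
  rewrite (linZ (bilin_ext_linr _ _)) bilin_ext_bvec ext_mul1 !inE eqxx /= setD1K //.
  rewrite (below_setD1 i it) ltnn add0n addr0 scalerA exprS mulN1r mulNr -expr2 sqrr_sign.
  by rewrite scaleN1r opprK addNr.
rewrite (linZ (lin_ext_lin _)) lin_ext_bvec /ext_diff big_setU1 //= scalerDr; congr (_ + _).
  rewrite setU1K // below_setU1 // ltnn add0n scalerA exprS mulN1r mulrN -expr2.
  by rewrite sqrr_sign scaleN1r.
rewrite scaler_sumr -sumrN; apply: eq_bigr => k kt.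
have ik : i != k by apply: contraNneq it => ->.
rewrite (linZ (bilin_ext_linr _ _)) bilin_ext_bvec ext_mul1 !inE (negPf it) andbF.
rewrite below_setU1 // !scalerA -scaleNr.
have -> : (i |: t) :\ k = i |: t :\ k.
  by apply/setP => x; rewrite !inE; case: (x =P i) => // ->; rewrite ik.
congr (_ *: _); rewrite -exprD -[X in _ = - X]exprD -[RHS]mulN1r -exprS (below_setD1 i kt).
move: ik; rewrite -val_eqE => ik; rewrite -[LHS]signr_odd -[RHS]signr_odd !(oddD, oddS, oddb).
by move: ik; case: ltngtP; case: (odd (below t k)); case: (odd (below (t :\ k) i)).
Qed.

Lemma ext_diff_mul1_lin i v : diff (mul (bvec [set i]) v) = - v - mul (bvec [set i]) (diff v).
Proof.
rewrite -(scaleN1r v) -(scaleN1r (mul _ _)).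
apply: (eq_lin (f := fun v => diff (mul (bvec [set i]) v))
  (g := fun v => -1 *: v + -1 *: mul (bvec [set i]) (diff v))) => [||t].
- exact: is_lin_comp (lin_ext_lin _) (bilin_ext_linr _ _).
- apply: is_linD; first by apply: is_linZ => c x y.
  by apply: is_linZ; exact: is_lin_comp (bilin_ext_linr _ _) (lin_ext_lin _).
by rewrite bilin_ext_bvec ext_diff_mul1 lin_ext_bvec !scaleN1r.
Qed.

Lemma ext_diff0 : ext_diff set0 = 0.
Proof. by rewrite /ext_diff big_set0. Qed.

Lemma ext_diffK s : diff (ext_diff s) = 0.
Proof.
move: s; apply: ext_ind => [|i t /ext_mul_min it IH].
  by rewrite ext_diff0 (lin0 (lin_ext_lin _)).
rewrite -[ext_diff _]lin_ext_bvec -it ext_diff_mul1 (linB (lin_ext_lin _)).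
rewrite (linN (lin_ext_lin _)) lin_ext_bvec ext_diff_mul1_lin IH (lin0 (bilin_ext_linr _ _)).
by rewrite subr0 opprK addNr.
Qed.

Lemma ext_leibniz s t : diff (ext_mul s t) =
  mul (ext_diff s) (bvec t) + (-1) ^+ #|s| *: mul (bvec s) (ext_diff t).
Proof.
move: s; apply: ext_ind => [|i s is_ IH].
  rewrite ext_mul0l lin_ext_bvec ext_diff0 (lin0 (bilin_ext_linl _ _)) add0r cards0 scale1r.
  apply: (eq_lin (f := id) (g := mul (bvec set0))) => // [|a]; first exact: bilin_ext_linr.
  by rewrite bilin_ext_bvec ext_mul0l.
have it : i \notin s by apply/negP => /is_; rewrite ltnn.
rewrite cardsU1 it -[ext_mul _ t]bilin_ext_bvec -(lin_ext_bvec ext_diff (i |: s)).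
rewrite -(ext_mul_min is_) ext_diff_mul1 -[ext_mul _ s]bilin_ext_bvec -!ext_mulA_lin.
rewrite ext_diff_mul1_lin bilin_ext_bvec IH (linB (bilin_ext_linl _ _)) (linN (bilin_ext_linl _ _)).
rewrite bilin_ext_bvec -ext_mulA_lin (linD (bilin_ext_linr _ _)) (linZ (bilin_ext_linr _ _)).
by rewrite add1n exprS mulN1r scaleNr opprD addrA.
Qed.

End Exterior.

(** * The sign of the atomic product *)

Lemma inversions_cat w1 w2 : inversions (w1 ++ w2) =
  (inversions w1 + inversions w2 + \sum_(a <- w1) count (fun b => b < a)%N w2)%N.
Proof.
elim: w1 => [|a w1 IH] /=; first by rewrite big_nil addn0.
by rewrite IH big_cons count_cat; lia.
Qed.

Lemma inversions_sorted w : sorted ltn w -> inversions w = 0%N.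
Proof.
elim: w => [|a w IH] //= aw; rewrite IH ?(path_sorted aw) // addn0.
apply/eqP; rewrite -[_ == _]negbK -lt0n -has_count; apply/hasPn => b bw.
by rewrite -leqNgt ltnW // (allP (order_path_min ltn_trans aw)).
Qed.

Lemma sorted_val_enum n (s : {set 'I_n}) : sorted ltn [seq val i | i <- enum s].
Proof.
apply: (subseq_sorted ltn_trans (s2 := iota 0 n)); last exact: iota_ltn_sorted.
by rewrite -val_enum_ord enumT; apply: map_subseq; exact: filter_subseq.
Qed.

(** Both lists are sorted, so all inversions of their concatenation are between an element of [s]
    and one of [t]. *)
Lemma eps_signE n (s t : {set 'I_n}) : [disjoint s & t] ->
  eps_sign s t = (-1) ^+ inv2 s t.
Proof.
move=> st; rewrite /eps_sign; case: pickP => [e /eqP E|none].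
  rewrite (permute_inversions e (sorted_val_enum (s :|: t))); last first.
    by rewrite size_map -cardE.
  rewrite -E map_cat inversions_cat !inversions_sorted ?sorted_val_enum // !add0n.
  congr (_ ^+ _); rewrite big_map big_enum /=; apply: eq_bigr => i _.
  rewrite count_map -sum1_count big_enum_cond /below [RHS]big_mkcond /= big_mkcondr /=.
  by rewrite [LHS]big_mkcond /=; apply: eq_bigr => j _; case: (j \in t) => //; case: (_ < _)%N.
(* The default value 0 is excluded: for disjoint sets the two lists are rearrangements of each
   other, so a permutation exists. *)
have szu : size [seq val i | i <- enum (s :|: t)] == #|s :|: t| by rewrite size_map -cardE.
have : perm_eq [seq val i | i <- enum s ++ enum t] (Tuple szu).
  apply: perm_map; apply: uniq_perm.
  - rewrite cat_uniq !enum_uniq andbT /=; apply/hasPn => i; rewrite !mem_enum => it.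
    by apply: contraL it => /(disjointFr st) ->.
  - exact: enum_uniq.
  by move=> i; rewrite mem_cat !mem_enum inE.
case/tuple_permP => p E; have := none (p^-1)%g; rewrite E => /eqP[].
rewrite /permute invgK /=; apply: eq_map => i /=.
by rewrite (tnth_nth 0%N).
Qed.

(** * The relative atomic algebra as an associated graded algebra *)

Section Atomic.
Variables (K : fieldType) (V : vectType K) (n : nat) (U : 'I_n -> {vspace V}).
Implicit Types (s t : {set 'I_n}) (i : 'I_n).

Lemma ssval_bot : ssval (\bot%O : ilat U) = fullv.
Proof. by rewrite /= /inter big_set0. Qed.

Lemma ssval_atom i : ssval (atom U i) = U i.
Proof. by rewrite /= /inter big_set1. Qed.

Lemma joinsU s t : joins U (s :|: t) = (joins U s `|` joins U t)%O.
Proof. exact: joins_setU. Qed.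

Lemma atom_le_joins i s : i \in s -> (atom U i <= joins U s)%O.
Proof. by move=> si; apply: (joins_sup _ si). Qed.

Definition ext_data : filt_data (ilat U) :=
  @FiltData _ (ilat U) {set 'I_n} (joins U) (fun s => #|s|) (@ext_diff n) (@ext_mul n) set0.

Lemma ext_is_filt_dga : is_filt_dga ext_data.
Proof.
split=> /=.
- by rewrite /joins big_set0.
- exact: cards0.
- move=> s; apply: supp_sum => i si; apply: suppZ; apply: supp_bvec.
  by rewrite (cardsD1 i s) si eqxx andbT; apply: le_joins; exact: subD1set.
- move=> s t; rewrite /ext_mul; case: ifP => st; last exact: supp0.
  apply: suppZ; apply: supp_bvec; rewrite joinsU eqxx /=.
  by rewrite cardsU (disjoint_setI0 st) cards0 subn0.
- exact: ext_diffK.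
- exact: ext_mulA.
- exact: ext_mul0l.
- exact: ext_mul0r.
- exact: ext_leibniz.
Qed.

(** An element above the bottom is the intersection of a nonempty subfamily; any member of it
    provides a generator. *)
Lemma ext_has_primitives : has_primitives ext_data.
Proof.
move=> x x0; have /codomP[s xs] := ssvalP x.
have [s0|/set0Pn[i si]] := eqVneq s set0.
  by case/eqP: x0; apply: val_inj; rewrite [LHS]xs s0.
exists [set i]; split=> /=; rewrite ?cards1 //.
  rewrite /joins big_set1 /Order.le /= /ilat_le xs ssval_atom.
  exact: bigcapv_inf si (subvv _).
rewrite /ext_diff big_set1 /below big_set1 ltnn expr1 scaleN1r.
by congr (- bvec _); apply/setP => j; rewrite !inE; case: eqP.
Qed.

Hypothesis U_proper : forall i, U i <> fullv.

Lemma ext_connected : connected_base ext_data.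
Proof.
move=> s /= sbot; apply/eqP; apply: contraPT isT => /set0Pn[i /atom_le_joins].
by rewrite sbot lex0 => /eqP E; case: (@U_proper i); rewrite -ssval_atom E ssval_bot.
Qed.

(** A common [j] puts both subspaces, hence their sum, inside the proper subspace [U j]; the
    dimension formula then makes the codimension of the intersection too small. *)
Lemma additive_disjoint s t :
  additive_labels (@cd K V n U) (joins U s) (joins U t) -> [disjoint s & t].
Proof.
move=> /eqP add; rewrite -setI_eq0; apply/negPn/negP => /set0Pn [j]; rewrite inE => /andP[sj tj].
have sx : (ssval (joins U s) <= U j)%VS by rewrite -ssval_atom; exact: atom_le_joins sj.
have tx : (ssval (joins U t) <= U j)%VS by rewrite -ssval_atom; exact: atom_le_joins tj.
have lt : (\dim (U j) < \dim {:V})%N.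
  rewrite (ltn_leqif (dimv_leqif_sup (subvf _))); apply/negP => UV.
  by apply: (U_proper (i := j)); apply/eqP; rewrite eqEsubv subvf.
have := dimv_sum_cap (ssval (joins U s)) (ssval (joins U t)).
have : (ssval (joins U s) + ssval (joins U t) <= U j)%VS by rewrite subv_add sx.
move/dimvS; have := dimvS (subvf (ssval (joins U s))).
have := dimvS (subvf (ssval (joins U t)));
have := dimvS (subvf (ssval (joins U s) :&: ssval (joins U t))%VS); move: add; rewrite /cd /=; lia.
Qed.

Lemma D_dga_gr : D_dga U = gr (@cd K V n U) ext_data.
Proof.
rewrite /D_dga /gr /=; congr DgData.
  congr lin_ext; apply: funext => s; rewrite /D_diff_basis /gr_diff /= /ext_diff.
  rewrite (lin_sum (restr_lin _)) big_mkcondr /=; apply: eq_bigr => i si.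
  rewrite (linZ (restr_lin _)) restr_bvec card_leq_below //.
  by case: ifP => _; rewrite ?scaler0.
congr bilin_ext; apply: funext => s; apply: funext => t; rewrite /D_mul_basis /gr_mul /=.
rewrite joinsU -/(additive_labels (@cd K V n U) _ _); case: ifP => // /additive_disjoint st.
by rewrite /ext_mul st eps_signE.
Qed.

End Atomic.

(** * Chains of joins *)

Section Chains.
Variables (disp : Order.disp_t) (L : bJoinSemilatticeType disp).
Implicit Types (z a b c : L) (u v w : seq L).
Local Open Scope order_scope.

Definition chain z w : seq L := scanl Order.join z w.
Definition strict z w : bool := path <%O z (chain z w).

Lemma strict_cons z a w : strict z (a :: w) = ~~ (a <= z) && strict (z `|` a) w.
Proof. by rewrite /strict /= lt_neqAle leUl andbT eq_sym eq_joinl. Qed.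

Lemma chain_joinl z b w : chain (z `|` b) w = [seq x `|` b | x <- chain z w].
Proof.
elim: w z => [|a w IH] z //=; rewrite joinAC; congr (_ :: _).
exact: IH.
Qed.

Lemma chain_join_eq z b u v : chain z u = chain z v -> chain (z `|` b) u = chain (z `|` b) v.
Proof. by rewrite !chain_joinl => ->. Qed.

Lemma strict_join z b w : strict (z `|` b) w -> strict z w.
Proof.
elim: w z => [|a w IH] z //; rewrite !strict_cons joinAC => /andP[ab /IH ->].
by rewrite andbT; apply: contra ab => /le_trans; apply; exact: leUl.
Qed.

Lemma size_chain z w : size (chain z w) = size w.
Proof. exact: size_scanl. Qed.

Lemma chain_path z w : path <=%O z w -> chain z w = w.
Proof. by elim: w z => [|a w IH] z //= /andP[za /IH]; rewrite (join_r za) => ->. Qed.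

Lemma path_chain z w : path <=%O z (chain z w).
Proof. by elim: w z => [|a w IH] z //=; rewrite leUl; exact: IH. Qed.

Lemma last_chain z w : last z (chain z w) = z `|` \join_(x <- w) x.
Proof.
elim: w z => [|a w IH] z /=; first by rewrite big_nil joinx0.
by rewrite IH big_cons joinA.
Qed.

Lemma join_seq_le z w : all (fun x => x <= z) w -> \join_(x <- w) x <= z.
Proof. by move=> /allP wz; apply/joinsP_seq => x xw _; exact: wz. Qed.

Lemma all_le_join_seq w : all (fun x => x <= \join_(y <- w) y) w.
Proof. by apply/allP => x xw; apply: (@joins_sup_seq _ L _ w predT id x xw). Qed.

Section Compat.
Variable M : lmodType rat.
Implicit Types F : seq L -> M.

(* Functions on words that factor through the normalized chain of partial
   joins starting at [z]. *)
Definition compat z F : Prop :=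
  (forall u v, chain z u = chain z v -> F u = F v)
  /\ (forall w, ~~ strict z w -> F w = 0%R).

Lemma compat_cons z a F : compat z F -> compat (z `|` a) (fun w => F (a :: w)).
Proof.
case=> F1 F2; split=> [u v uv|w nw]; first by apply: F1; rewrite /= -!/(chain _ _) uv.
by apply: F2; rewrite strict_cons negb_and nw orbT.
Qed.

(** Inserting letters of [v] joins them to all later partial joins. This preserves equality of
    chains, and a redundant letter stays redundant whatever is inserted before it. *)
Lemma compat_shs z F v : compat z F -> compat z (fun w => shs F w v).
Proof.
elim: v z F => [|b v IHv] z F zF.
  case: zF => F1 F2.
  by split=> [u v uv|w nw]; rewrite ?shs0r; [exact: F1 | exact: F2].
split=> [u u' uu'|w nw].
  elim: u u' z F zF uu' => [|a u IHu] [|a' u'] z F zF //= -[aa uu].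
  have IH2 := (IHv _ _ (compat_cons b zF)).1.
  have uu' : chain z (a :: u) = chain z (a' :: u') by rewrite /chain /= -!/(chain _ _) uu aa.
  have su : size u = size u' by rewrite -(size_chain (z `|` a)) -/(chain _ _) uu size_chain.
  rewrite !shs_cons su; congr (_ + _ *: _)%R; last by apply: IH2; exact: chain_join_eq.
  rewrite (IHu u' _ _ (compat_cons a zF)) -?/(chain _ _); last by rewrite uu -aa.
  by apply: eq_shs => x _; apply: zF.1; rewrite /= aa.
elim: w z F zF nw => [|a w IHw] z F zF //; rewrite strict_cons negb_and negbK => nw.
rewrite shs_cons [X in (_ + _ *: X)%R](IHv _ _ (compat_cons b zF)).2 ?scaler0 ?addr0; last first.
  apply/negP => /strict_join; rewrite strict_cons; case/orP: nw => [-> //|/negPf ->].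
  by rewrite andbF.
have [az|az] := boolP (a <= z); last by rewrite (IHw _ _ (compat_cons a zF)) //; case/orP: nw => // /(negP az).
by apply: shs_eq0 => x; apply: zF.2; rewrite strict_cons az.
Qed.

Lemma compat_shsr z F u : compat z F -> compat z (shs F u).
Proof.
move=> zF; have [H1 H2] := compat_shs u zF; split=> [v v' vv'|w nw].
  by rewrite shsC [RHS]shsC (H1 _ _ vv') -(size_chain z v) vv' size_chain.
by rewrite shsC H2 ?scaler0.
Qed.

Local Notation bd := (bdm (@Order.join disp L)).

Lemma bd_compat z F u v : compat z F -> chain z u = chain z v -> bd F u = bd F v.
Proof.
elim: u v z F => [|a u IHu] [|a' u'] z F zF //= -[aa uu].
congr (- _ - _)%R; last first.
  rewrite (IHu u' _ _ (compat_cons a zF)) -?/(chain _ _); last by rewrite uu -aa.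
  by apply: eq_bdm => x _; apply: zF.1; rewrite /= aa.
move: uu; case: u {IHu} => [|c u]; case: u' => [|c' u'] //= -[cc uu].
by apply: zF.1; rewrite /chain /= -!/(chain _ _) !joinA uu cc.
Qed.

(* The face missing from [bd], deletion of the first letter, is the only one
   that could survive when the first letter is redundant. *)
Lemma bd_redundant z F a w : compat z F -> a <= z -> bd F (a :: w) = (- F w)%R.
Proof.
move=> zF az; rewrite bdm_cons; have -> : bd (fun x => F (a :: x)) w = 0%R.
  have -> : 0%R = bd (fun _ => 0%R : M) w.
    by elim: w => //= b w <-; rewrite subr0; case: w => /=; rewrite oppr0.
  by apply: eq_bdm => x _; apply: zF.2; rewrite strict_cons az.
rewrite subr0; congr (- _)%R; case: w => [|c w] //=.
by apply: zF.1; rewrite /= joinA (join_l az).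
Qed.

(** When a partial join repeats, the faces deleting either copy agree and have opposite signs, and
    every other face keeps the repetition. A redundant first letter would repeat [z], for which
    there is no face; this is excluded by the hypothesis on [a]. *)
Lemma bd_nonstrict z F a w : compat z F -> ~~ (a <= z) -> ~~ strict z (a :: w) ->
  bd F (a :: w) = 0%R.
Proof.
elim: w z a F => [|c w IHw] z a F zF az; rewrite strict_cons az //= => nw.
rewrite -/(bd (fun x => F (a :: x)) (c :: w)).
have [cza|cza] := boolP (c <= z `|` a).
  rewrite (bd_redundant _ (compat_cons a zF)) // opprK.
  apply/eqP; rewrite addrC subr_eq0; apply/eqP; apply: zF.1.
  by rewrite /= joinA (join_l cza).
rewrite (IHw _ _ _ (compat_cons a zF)) // subr0 zF.2 ?oppr0 //.
by move: nw; rewrite !strict_cons cza /= joinA negb_and => ->; rewrite orbT.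
Qed.

End Compat.

(* On a chain, merging two adjacent letters amounts to deleting the first. *)
Lemma bdm_sorted (M : lmodType rat) (F : seq L -> M) w : sorted <=%O w ->
  (bdm (@Order.join disp L) F w = \sum_(j < size w) (-1) ^+ j.+1 *: F (del j w))%R.
Proof.
elim: w F => [|a w IHw] F sw; first by rewrite big_ord0.
rewrite bdm_cons (IHw _ (path_sorted sw)) big_ord_recl /= expr1 scaleN1r /del /= drop0.
congr (- _ + _)%R.
  by case: w sw {IHw} => [|c w] //= /andP[ac _]; rewrite (join_r ac).
rewrite -sumrN; apply: eq_bigr => j _.
by rewrite [in RHS]exprS mulN1r scaleNr.
Qed.

End Chains.

(** * The filtered algebra of flags *)

Lemma sorted_comparable (disp : Order.disp_t) (T : porderType disp) (t : seq T) x y :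
  sorted <%O t -> x \in t -> y \in t -> (x >=< y)%O.
Proof.
move=> st xt yt; rewrite /Order.comparable.
have nle := sorted_leq_nth le_trans le_refl x (sub_sorted (@ltW _ _) st).
have [ij|/ltnW ij] := leqP (index x t) (index y t).
  by have := nle (index x t) (index y t); rewrite !inE !index_mem !nth_index // => ->.
by have := nle (index y t) (index x t); rewrite !inE !index_mem !nth_index // => ->;
  rewrite ?orbT.
Qed.

Section Flags.
Variables (K : fieldType) (V : vectType K) (n : nat) (U : 'I_n -> {vspace V}).
Local Notation L := (ilat U).
Local Notation bot := (\bot%O : L).
Implicit Types (A x y z : L) (T : {set L}) (w : seq L) (a b : flag U).

(** The elements of the extended chain serve as increments, since their partial joins return the
    chain ([chain_word]). The unit is the empty word. *)
Definition word b : seq L :=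
  if (val b).1 == bot then [::] else ext_list (val b).1 (val b).2.

(** Unlike in [lambda_vec], the chain must start strictly above the bottom; a first letter equal to
    the bottom thus counts as a repetition, as [compat] demands. *)
Definition lvec w : freeQ (flag U) :=
  if strict bot w
  then flag_vec (last bot (chain bot w)) ([set x in chain bot w] :\ last bot (chain bot w))
  else 0.

Lemma is_flagP A T : is_flag (A, T) ->
  (forall x, x \in T -> (bot < x)%O /\ (x < A)%O) /\
  (forall x y, x \in T -> y \in T -> (x >=< y)%O).
Proof.
case/andP => /forall_inP H1 /forall_inP H2; split=> [x /H1 /andP[] //|x y xT yT].
exact: (forall_inP (H2 _ xT)).
Qed.

Lemma flag_bot T : is_flag (bot, T) -> T = set0.
Proof.
case/is_flagP => H _; apply/setP => x; rewrite inE; apply/negP => /H[_].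
by rewrite ltx0.
Qed.

Lemma sort_flag A T : is_flag (A, T) -> sorted <%O (sort <=%O (enum T)).
Proof.
case/is_flagP => _ Tc; rewrite lt_sorted_uniq_le sort_uniq enum_uniq /=.
apply: (sort_sorted_in (P := mem T)); last by apply/allP => x; rewrite mem_enum.
by move=> x y xT yT; exact: Tc.
Qed.

Lemma path_ext_list A T : is_flag (A, T) -> A != bot -> path <%O bot (ext_list A T).
Proof.
move=> TA A0; have [H _] := is_flagP TA; rewrite /ext_list rcons_path.
rewrite path_min_sorted ?(sort_flag TA) /=; last first.
  by apply/allP => x; rewrite mem_sort mem_enum => /H[].
have := mem_last bot (sort <=%O (enum T)).
rewrite inE mem_sort mem_enum => /orP[/eqP ->|/H[] //].
by rewrite lt0x.
Qed.

Lemma word_path b : path <%O bot (word b).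
Proof.
case: b => [[A T] TA]; rewrite /word /=; case: ifPn => // A0.
exact: path_ext_list.
Qed.

Lemma lt_path_chain z w : path <%O z w -> chain z w = w.
Proof. by move=> zw; apply: chain_path; apply: sub_path zw => x y; exact: ltW. Qed.

Lemma chain_word b : chain bot (word b) = word b.
Proof. exact/lt_path_chain/word_path. Qed.

Lemma strict_word b : strict bot (word b).
Proof. by rewrite /strict chain_word word_path. Qed.

Lemma last_word b : last bot (word b) = (val b).1.
Proof. by rewrite /word; case: eqP => [->|] //; rewrite last_rcons. Qed.

Lemma flag_vec_val b : flag_vec (val b).1 (val b).2 = bvec b.
Proof.
by rewrite /flag_vec; case: b => [[A T] TA] /=; rewrite insubT.
Qed.

Lemma lvec_word b : lvec (word b) = bvec b.
Proof.
rewrite /lvec strict_word chain_word last_word -flag_vec_val; congr flag_vec.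
case: b => [[A T] TA]; rewrite /word /=; case: eqP => [A0|_] /=.
  rewrite A0 in TA *; rewrite (flag_bot TA).
  by apply/setP => x; rewrite !inE andbF.
apply/setP => x; rewrite !inE mem_rcons inE mem_sort mem_enum.
case: eqP => //= ->; apply/esym/negP => /(is_flagP TA).1[_].
by rewrite ltxx.
Qed.

Definition mk_flag A T (TA : is_flag (A, T)) : flag U :=
  exist (fun AT : L * {set L} => is_flag AT) (A, T) TA.

Fact flag_one_subproof : is_flag (bot, set0 : {set L}).
Proof. by apply/andP; split; apply/forall_inP => x; rewrite inE. Qed.

Definition flag_one : flag U := mk_flag flag_one_subproof.

Lemma word_one : word flag_one = [::].
Proof. by rewrite /word /= eqxx. Qed.

Lemma flag_of_path w : path <%O bot w -> exists b, word b = w.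
Proof.
case/lastP: w => [|t A] pw.
  by exists flag_one; rewrite word_one.
have A0 : A != bot.
  have := order_path_min lt_trans pw; rewrite all_rcons lt0x.
  by case/andP.
have st := path_sorted pw.
have := st; rewrite (sorted_pairwise lt_trans) pairwise_rcons => /andP[tA pt].
have st' : sorted <%O t by rewrite (sorted_pairwise lt_trans).
have TA : is_flag (A, [set x in t]).
  apply/andP; split; apply/forall_inP => x; rewrite inE => xt /=.
    rewrite (allP tA _ xt) andbT (allP (order_path_min lt_trans pw)) //.
    by rewrite mem_rcons inE xt orbT.
  apply/forall_inP => y; rewrite inE => yt; exact: (sorted_comparable st').
exists (mk_flag TA); rewrite /word /= (negPf A0) /ext_list; congr rcons.
apply: (lt_sorted_eq (sort_flag TA) st') => x.
by rewrite mem_sort mem_enum inE.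
Qed.

Lemma lvec_compat : compat bot lvec.
Proof.
split=> [u v uv|w /negPf nw]; last by rewrite /lvec nw.
by rewrite /lvec /strict uv.
Qed.

Variant lvec_spec w : freeQ (flag U) -> bool -> Type :=
| LvecFlag b of chain bot w = word b : lvec_spec w (bvec b) true
| LvecZero of ~~ strict bot w : lvec_spec w 0 false.

Lemma lvecP w : lvec_spec w (lvec w) (strict bot w).
Proof.
have [sw|sw] := boolP (strict bot w); last by rewrite lvec_compat.2 //; exact: LvecZero.
have /cid [b wb] := flag_of_path sw.
by rewrite (lvec_compat.1 w (word b)) ?lvec_word ?chain_word //; exact: LvecFlag.
Qed.

(** A [compat] function sees only the normalized chain, hence is a linear function of [lvec w]. This
    is how operations on words descend to chains. *)
Lemma lin_ext_lvec (M : lmodType rat) (F : seq L -> M) w : compat bot F ->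
  lin_ext (fun b => F (word b)) (lvec w) = F w.
Proof.
move=> Fc; case: lvecP => [b wb|nw]; last by rewrite (lin0 (lin_ext_lin _)) Fc.2.
by rewrite lin_ext_bvec; apply: Fc.1; rewrite chain_word.
Qed.

Local Notation bd := (bdm (@Order.join _ L)).
Definition nonbot : pred L := fun x => x != bot.

Lemma nonbot_join x y : nonbot x -> nonbot y -> nonbot (x `|` y)%O.
Proof.
by rewrite /nonbot => x0 _; rewrite -lt0x (lt_le_trans _ (leUl x y)) ?lt0x.
Qed.

(** [bd lvec] is not [compat] at a redundant first letter. Without bottom letters this cannot occur,
    and [bd_nonstrict] covers the other repetitions. *)
Lemma lin_ext_bd w : all nonbot w -> lin_ext (fun b => bd lvec (word b)) (lvec w) = bd lvec w.
Proof.
move=> w0; case: lvecP => [b wb|nw].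
  by rewrite lin_ext_bvec; apply: bd_compat lvec_compat _; rewrite chain_word.
rewrite (lin0 (lin_ext_lin _)); case: w w0 nw => [|x w] //= /andP[x0 _] nw.
by rewrite -bdm_cons (bd_nonstrict lvec_compat) ?lex0.
Qed.

Lemma word_nonbot b : all nonbot (word b).
Proof.
apply: sub_all (order_path_min lt_trans (word_path b)) => x.
by rewrite lt0x.
Qed.

Lemma supp_lvec w : supp (fun b => ((val b).1 == \join_(x <- w) x)%O
  && (size (word b) == size w)) (lvec w).
Proof.
case: lvecP => [b wb|_]; last exact: supp0.
apply: supp_bvec; rewrite -last_word -wb last_chain join0x eqxx.
by rewrite size_chain eqxx.
Qed.

Lemma join_word b : (\join_(x <- word b) x)%O = (val b).1.
Proof. by rewrite -last_word -{2}(chain_word b) last_chain join0x. Qed.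

(** The size counts the label as a letter, which accounts for the shift by 1 in [CM_deg]. *)
Definition flag_data : filt_data L :=
  @FiltData _ L (flag U) (fun b => (val b).1) (fun b => size (word b))
    (fun b => bd lvec (word b)) (fun a b => shs lvec (word a) (word b)) flag_one.

Local Notation mul := (bilin_ext (@fmul _ _ flag_data)).
Local Notation diff := (lin_ext (@fdiff _ _ flag_data)).

Lemma mul_lvecl w b : mul (lvec w) (bvec b) = shs lvec w (word b).
Proof.
rewrite -(lin_ext_lvec w (compat_shs (word b) lvec_compat)).
apply: (eq_lin (f := fun v => mul v (bvec b))
  (g := lin_ext (fun a => shs lvec (word a) (word b)))) => [||a].
- exact: bilin_ext_linl.
- exact: lin_ext_lin.
by rewrite bilin_ext_bvec lin_ext_bvec.
Qed.

Lemma mul_lvecr a w : mul (bvec a) (lvec w) = shs lvec (word a) w.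
Proof.
rewrite -(lin_ext_lvec w (compat_shsr (word a) lvec_compat)).
by rewrite bilin_ext_bvecl.
Qed.

Lemma flag_is_filt_dga : is_filt_dga flag_data.
Proof.
split=> //=.
- by rewrite word_one.
- move=> b; apply: (@bdm_closed _ _ _ _ (fun x => (x <= (val b).1)%O)).
  + exact: supp0.
  + by move=> c u v; exact: suppP.
  + by move=> x y xb yb; rewrite leUx xb.
  + move=> w sw wb; apply: (sub_supp (@supp_lvec w)) => c /andP[/eqP -> /eqP ->].
    by rewrite sw eqxx andbT join_seq_le.
  + by rewrite -{1}join_word all_le_join_seq.
- move=> a b; apply: shs_closed => [c u v|w pw]; first exact: suppP.
  apply: (sub_supp (@supp_lvec w)) => c /andP[/eqP -> /eqP ->].
  by rewrite (perm_big _ pw) big_cat /= !join_word (perm_size pw) size_cat !eqxx.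
- move=> b; rewrite (lin_bdm _ _ _ (lin_ext_lin _)).
  rewrite -[RHS](bdmK (@joinA _ L) lvec (word b)).
  apply: (eq_bdm_in (Q := nonbot)) (word_nonbot b); first exact: nonbot_join.
  by move=> w _ w0; exact: lin_ext_bd.
(* Products can be computed on any word representing a chain ([mul_lvecl], [mul_lvecr]), so
   associativity becomes [shsA]. *)
- move=> a b c; transitivity (shs (fun w => shs lvec (word a) w) (word b) (word c)).
    rewrite (lin_shs _ _ _ (bilin_ext_linr _ _)).
    by apply: eq_shs => w _; exact: mul_lvecr.
  rewrite -[LHS](shsA lvec (word a)) (lin_shs _ _ _ (bilin_ext_linl _ _)).
  by apply: eq_shs => w _; rewrite mul_lvecl.
- by move=> b; rewrite word_one shs0l lvec_word.
- by move=> b; rewrite word_one shs0r lvec_word.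
(* Shuffles of words of flags contain no bottom letter, so [lin_ext_bd] applies to each and the
   Leibniz rule becomes [shs_bdm]. *)
- move=> a b; rewrite (lin_shs _ _ _ (lin_ext_lin _)).
  rewrite (@eq_shs_in _ _ nonbot _ (bd lvec)) ?word_nonbot //; last first.
    by move=> w _ w0; exact: lin_ext_bd.
  rewrite (shs_bdm (@joinC _ L)) (lin_bdm _ _ _ (bilin_ext_linl _ _)).
  rewrite (lin_bdm _ _ _ (bilin_ext_linr _ _)); congr (_ + _ *: _).
    by apply: eq_bdm => w _; rewrite mul_lvecl.
  by apply: eq_bdm => w _; rewrite mul_lvecr.
Qed.

End Flags.

Lemma count_le_sorted (disp : Order.disp_t) (T : porderType disp) (x0 : T) t j :
  sorted <%O t -> (j < size t)%N -> count (fun y => y <= nth x0 t j)%O t = j.+1.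
Proof.
elim: t j => [|a t IHt] [|j] //= st jt.
  rewrite lexx add1n; congr _.+1; apply/eqP; rewrite -[_ == _]negbK -lt0n -has_count.
  by apply/hasPn => b bt; rewrite lt_geF // (allP (order_path_min lt_trans st)).
rewrite IHt ?(path_sorted st) // ltW ?add1n //.
by rewrite (allP (order_path_min lt_trans st)) // mem_nth.
Qed.

Lemma del_rcons (T : Type) (t : seq T) x j :
  (j < size t)%N -> del j (rcons t x) = rcons (del j t) x.
Proof.
elim: t j => [|a t IHt] [|j] //= jt; first by rewrite /del /= !drop0.
by rewrite /del /= -!/(del _ _) IHt.
Qed.

Lemma perm_del (T : eqType) (x0 : T) (t : seq T) j :
  (j < size t)%N -> perm_eq t (nth x0 t j :: del j t).
Proof.
move=> jt; rewrite -{1}(cat_take_drop j t) (drop_nth x0 jt) -cat1s.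
by rewrite perm_catCA.
Qed.

(** * The algebra of flags as an associated graded algebra *)

Section FlagAlgebra.
Variables (K : fieldType) (V : vectType K) (n : nat) (U : 'I_n -> {vspace V}).
Local Notation L := (ilat U).
Local Notation bot := (\bot%O : L).
Implicit Types (A x y z : L) (T : {set L}) (w : seq L) (a b : flag U).

Lemma nonbot_chain z w : all (@nonbot _ _ _ U) w -> all (@nonbot _ _ _ U) (chain z w).
Proof.
elim: w z => [|x w IHw] z //= /andP[x0 /IHw ->]; rewrite andbT joinC.
by rewrite /nonbot -lt0x (lt_le_trans _ (leUl x z)) ?lt0x.
Qed.

Lemma lambda_vec_lvec w : all (@nonbot _ _ _ U) w -> lambda_vec w = lvec w.
Proof.
move=> w0; rewrite /lambda_vec /lvec -/(chain bot w).
have -> // : uniq (lambda w) = strict bot w.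
rewrite /strict -[RHS]/(sorted <%O (bot :: chain bot w)) lt_sorted_uniq_le /= path_chain andbT.
rewrite (_ : bot \notin _ = true) //; apply/negP => /(allP (nonbot_chain bot w0)).
by rewrite /nonbot eqxx.
Qed.

Lemma size_ext_list A T : size (ext_list A T) = #|T|.+1.
Proof. by rewrite size_rcons size_sort -cardE. Qed.

Lemma CM_mul_gr a b : CM_mul_basis a b = @gr_mul _ _ (@cd K V n U) (flag_data U) a b.
Proof.
rewrite /gr_mul /additive_labels /=.
case: a => [[A T] TA]; case: b => [[B T'] TB]; rewrite /CM_mul_basis /=.
rewrite -/(mk_flag TA) -/(mk_flag TB); set a := mk_flag TA; set b := mk_flag TB.
have cd0 := cdim0 (cd_codim_axioms U).
have wE C S (CS : is_flag (C, S)) : C != bot -> word (mk_flag CS) = ext_list C S.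
  by rewrite /word /= => /negPf ->.
have [A0|A0] := eqVneq A bot.
  rewrite [word a]/word /= A0 eqxx shs0l lvec_word join0x cd0 add0n eqxx //.
have [B0|B0] := eqVneq B bot.
  rewrite [word b]/word /= B0 eqxx shs0r lvec_word joinx0 cd0 addn0 eqxx //.
case: ifP => // _; rewrite (wE _ _ TA A0) (wE _ _ TB B0).
rewrite -(@eq_shs_in _ _ (@nonbot _ _ _ U) (@lambda_vec _ _ _ U)); first last.
- by rewrite -(wE _ _ TB B0) word_nonbot.
- by rewrite -(wE _ _ TA A0) word_nonbot.
- by move=> w _; exact: lambda_vec_lvec.
rewrite -(@sum_shuffles _ bot _ (#|T|.+1 + #|T'|.+1)) ?size_ext_list //.
Qed.

Lemma CM_diff_gr b : CM_diff_basis b = @gr_diff _ _ (flag_data U) b.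
Proof.
rewrite /gr_diff /=.
have wp := word_path b; move: wp; rewrite /word.
case: b => [[A T] TA]; rewrite /CM_diff_basis /=.
have [A0|A0] := eqVneq A bot.
  rewrite A0 in TA *; rewrite (flag_bot TA) big_set0 /=.
  by rewrite (lin0 (restr_lin _)).
move=> wp; rewrite bdm_sorted; last first.
  by apply: (sub_sorted (@ltW _ _)); exact: path_sorted wp.
(* The last summand deletes [A]; its label is strictly smaller, so the graded differential drops it
   and the faces at the elements of [T] remain. *)
rewrite size_ext_list big_ord_recr /=.
set t := sort <=%O (enum T); have st : size t = #|T| by rewrite size_sort -cardE.
have delt : del #|T| (ext_list A T) = t.
  by rewrite /del /ext_list -/t -cats1 take_size_cat // drop_oversize ?cats0 // size_cat addn1 st.
rewrite delt (linD (restr_lin _)) (linZ (restr_lin _)) [X in _ *: X]restr_eq0; last first.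
  apply: (sub_supp (@supp_lvec _ _ _ _ t)) => c /andP[/eqP ct _] /=.
  rewrite ct; move: wp; rewrite /ext_list -/t rcons_path => /andP[pt tA].
  rewrite -[X in X != _](join0x) -last_chain lt_path_chain //.
  by rewrite lt_eqF.
rewrite scaler0 addr0 (lin_sum (restr_lin _)).
rewrite -big_enum -(perm_big _ (permEl (perm_sort <=%O (enum T)))) -/t.
rewrite (big_nth bot) big_mkord st; apply: eq_bigr => j _.
have jt : (j < size t)%N by rewrite st.
have sst : sorted <%O t := sort_flag TA.
have dj : del j (ext_list A T) = rcons (del j t) A.
  exact: del_rcons.
have pd : path <%O bot (rcons (del j t) A).
  rewrite -dj; apply: (subseq_path lt_trans) wp.
  rewrite -[X in subseq _ X](cat_take_drop j) cat_subseq //.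
  by rewrite -addn1 addnC -drop_drop drop_subseq.
rewrite (linZ (restr_lin _)) dj restr_id; last first.
  apply: (sub_supp (@supp_lvec _ _ _ _ _)) => c /andP[/eqP -> _] /=.
  by rewrite -[X in X == _]join0x -last_chain lt_path_chain // last_rcons.
(* The element at index [j], counted from 0, has [j.+1] elements of [T] at or below it, which is the
   exponent in [bdm_sorted]. *)
congr (_ ^+ _ *: _).
  rewrite -(count_le_sorted bot sst jt) (permP (permEl (perm_sort <=%O (enum T)))).
  by rewrite -sum1dep_card -big_enum_cond sum1_count.
rewrite /lvec /strict !lt_path_chain // pd last_rcons; congr flag_vec.
have pdel := perm_del bot jt; have ut : uniq t by rewrite sort_uniq enum_uniq.
have := ut; rewrite (perm_uniq pdel) /= => /andP[tj _].
have AT : A \notin t.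
  by rewrite mem_sort mem_enum; apply/negP => /(is_flagP TA).1[_]; rewrite ltxx.
have Tt x : (x \in T) = (x \in t) by rewrite mem_sort mem_enum.
apply/setP => x; rewrite !inE mem_rcons inE Tt (perm_mem pdel) inE.
have [-> /=|xA] := eqVneq x A.
  by rewrite (perm_mem pdel) inE in AT; rewrite (negPf AT) andbF.
by rewrite /=; have [->|_] := eqVneq x (nth bot t j); rewrite ?(negPf tj).
Qed.

Lemma CM_dga_gr : CM_dga U = gr (@cd K V n U) (flag_data U).
Proof.
rewrite /CM_dga /gr /=; congr DgData.
- congr basis_homog; apply: funext => b; rewrite /gr_deg /=.
  case: b => [[A T] TA]; rewrite /CM_deg /word /=; case: eqP => [->|_] /=.
    by rewrite (cdim0 (cd_codim_axioms U)).
  by rewrite size_ext_list -[#|T|.+1]addn1 PoszD opprD addrA.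
- by congr lin_ext; apply: funext => b; exact: CM_diff_gr.
- by congr bilin_ext; apply: funext => a; apply: funext => b; exact: CM_mul_gr.
- exact: (flag_vec_val (flag_one U)).
Qed.

Lemma flag_connected : connected_base (flag_data U).
Proof.
case=> [[A T] TA] /= A0; apply: val_inj => /=.
by rewrite A0 in TA *; rewrite (flag_bot TA).
Qed.

Lemma atom_flag_subproof x : is_flag (x, set0 : {set L}).
Proof. by apply/andP; split; apply/forall_inP => y; rewrite inE. Qed.

Definition flag1 x : flag U := mk_flag (atom_flag_subproof x).

Lemma word_flag1 x : x != bot -> word (flag1 x) = [:: x].
Proof.
move=> /negPf x0; rewrite /word /= x0 /ext_list (_ : enum set0 = [::]) //.
by apply: size0nil; rewrite -cardE cards0.
Qed.

Lemma flag1_diff x : x != bot -> @fdiff _ _ (flag_data U) (flag1 x) = - bvec (flag_one U).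
Proof.
move=> x0; rewrite /= word_flag1 //= subr0 -lvec_word word_one //.
Qed.

Lemma flag_has_primitives : has_primitives (flag_data U).
Proof.
move=> x x0; exists (flag1 x); split; [by [] | by rewrite /= word_flag1 |].
exact: flag1_diff.
Qed.

End FlagAlgebra.

(** * The comparison morphism *)

Lemma enum_setU1_min n (i : 'I_n) (t : {set 'I_n}) :
  (forall j, j \in t -> (i < j)%N) -> enum (i |: t) = i :: enum t.
Proof.
move=> it; apply: (inj_map val_inj).
apply: (irr_sorted_eq ltn_trans ltnn); first exact: sorted_val_enum.
  rewrite /= path_min_sorted ?sorted_val_enum //.
  by apply/allP => _ /mapP[j jt ->]; apply: it; rewrite mem_enum in jt.
move=> x; apply/mapP/mapP => -[j jt ->]; exists j => //; move: jt.
  by rewrite mem_enum !inE mem_enum.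
by rewrite mem_enum !inE mem_enum.
Qed.

(* The universal property of the exterior algebra, in filtered form. *)
Section Universal.
Variables (K : fieldType) (V : vectType K) (n : nat) (U : 'I_n -> {vspace V}).
Variables (Y : filt_data (ilat U)) (x : 'I_n -> fbase Y).
Implicit Types (s t : {set 'I_n}) (i j : 'I_n).
Hypothesis YP : is_filt_dga Y.
Hypothesis x_lab : forall i, flab (x i) = atom U i.
Hypothesis x_sz : forall i, fsz (x i) = 1%N.
Hypothesis x_diff : forall i, fdiff (x i) = - bvec (fone Y).
Hypothesis x_anticomm : forall i j, fmul (x i) (x j) = - fmul (x j) (x i).
Hypothesis x_square : forall i, fmul (x i) (x i) = 0.

Local Notation X := (ext_data U).
Local Notation mulX := (bilin_ext (@fmul _ _ X)).
Local Notation mulY := (bilin_ext (@fmul _ _ Y)).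
Local Notation gen i := (bvec (x i)).

Definition atom_prod s : freeQ (fbase Y) :=
  foldr (fun i v => mulY (gen i) v) (bvec (fone Y)) (enum s).

Lemma atom_prod0 : atom_prod set0 = bvec (fone Y).
Proof.
by rewrite /atom_prod (_ : enum set0 = [::]) //; apply: size0nil; rewrite -cardE cards0.
Qed.

Lemma atom_prod_min i t : (forall j, j \in t -> (i < j)%N) ->
  atom_prod (i |: t) = mulY (gen i) (atom_prod t).
Proof. by move=> it; rewrite /atom_prod enum_setU1_min. Qed.

(** Induction through the least element [j] of the set: [i] is prepended if [i < j], anticommutes
    past [j] if [j < i], and squares to zero if they are equal. *)
Lemma atom_prod_mul1 i t :
  lin_ext atom_prod (ext_mul [set i] t) = mulY (gen i) (atom_prod t).
Proof.
move: t; apply: ext_ind => [|j t jt IH].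
  rewrite ext_mul_min => [|k]; last by rewrite inE.
  by rewrite lin_ext_bvec atom_prod_min // => k; rewrite inE.
rewrite atom_prod_min //; have [ij|ji|ij] := ltngtP (val i) (val j).
- rewrite ext_mul_min ?lin_ext_bvec ?atom_prod_min // => k;
    by rewrite !inE => /orP[/eqP -> //|/jt]; exact: ltn_trans.
- rewrite (fmul_anticomm YP (atom_prod t) (x_anticomm i j)) -IH (ext_mul1 i (j |: t)) (ext_mul1 i t) in_setU1.
  have -> /= : (i == j) = false by rewrite -val_eqE gtn_eqF.
  case: ifPn => it; first by rewrite (lin0 (lin_ext_lin _)) (lin0 (bilin_ext_linr _ _)) oppr0.
  rewrite !(linZ (lin_ext_lin _)) !lin_ext_bvec (linZ (bilin_ext_linr _ _)).
  rewrite below_setU1; last by apply/negP => /jt; rewrite ltnn.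
  rewrite ji add1n exprS mulN1r scaleNr setUCA; congr (- (_ *: _)).
  by apply: atom_prod_min => k; rewrite !inE => /orP[/eqP -> //|/jt].
- have -> : i = j by apply: val_inj.
  by rewrite (fmul_square0 YP _ (x_square j)) ext_mul1 !inE eqxx (lin0 (lin_ext_lin _)).
Qed.

Lemma atom_prod_gen i v :
  lin_ext atom_prod (mulX (bvec [set i]) v) = mulY (gen i) (lin_ext atom_prod v).
Proof.
apply: (eq_lin (f := fun v => lin_ext atom_prod (mulX (bvec [set i]) v))
  (g := fun v => mulY (gen i) (lin_ext atom_prod v))) => [||t].
- exact: is_lin_comp (lin_ext_lin _) (bilin_ext_linr _ _).
- exact: is_lin_comp (bilin_ext_linr _ _) (lin_ext_lin _).
by rewrite bilin_ext_bvec lin_ext_bvec; exact: atom_prod_mul1.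
Qed.

Lemma atom_prod_morph : @is_filt_morph _ _ X Y atom_prod.
Proof.
have XP := ext_is_filt_dga U.
split.
- apply: ext_ind => [|i t it IH].
    rewrite atom_prod0; apply: supp_bvec.
    by rewrite (flab1 YP) (fsz1 YP) /= (flab1 XP : joins U set0 = _) cards0 !eqxx.
  rewrite (atom_prod_min it) bilin_ext_bvecl; apply: (supp_lin_ext IH) => b.
  case/andP => /eqP bl /eqP bs.
  apply: (sub_supp (fmul_supp YP (x i) b)) => c /andP[/eqP -> /eqP ->].
  rewrite bl bs x_lab x_sz /= joinsU cardsU1.
  have -> : i \notin t by apply/negP => /it; rewrite ltnn.
  by rewrite /joins big_set1 !eqxx.
- exact: atom_prod0.
- apply: ext_ind => [|i t it IH].
    rewrite (fdiff_one XP) (lin0 (lin_ext_lin _)) atom_prod0 lin_ext_bvec.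
    by rewrite (fdiff_one YP).
  rewrite (atom_prod_min it) (fdiff_mul_primitive YP _ (x_sz i) (x_diff i)).
  rewrite -IH -atom_prod_gen.
  have -> : @fdiff _ _ X (i |: t) = - bvec t - mulX (bvec [set i]) (@fdiff _ _ X t).
    by rewrite -[LHS]lin_ext_bvec -(ext_mul_min it); exact: ext_diff_mul1.
  by rewrite (linB (lin_ext_lin _)) (linN (lin_ext_lin _)) lin_ext_bvec.
- move=> s t; move: s; apply: ext_ind => [|i s is_ IH].
    rewrite (fmul1l XP) lin_ext_bvec atom_prod0.
    apply: (eq_lin (f := id) (g := mulY (bvec (fone Y)))) => // [|b].
      exact: bilin_ext_linr.
    by rewrite bilin_ext_bvec (fmul1l YP).
  rewrite (atom_prod_min is_) -(fmulA_lin YP) -IH -atom_prod_gen.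
  rewrite -[X in mulX _ X]bilin_ext_bvec (fmulA_lin XP); congr (lin_ext _ _).
  by rewrite !bilin_ext_bvec [@fmul _ _ X _ s](ext_mul_min is_) bilin_ext_bvec.
Qed.

End Universal.

Lemma shs11 (T : Type) (M : lmodType rat) (F : seq T -> M) x y :
  shs F [:: x] [:: y] = F [:: x; y] - F [:: y; x].
Proof. by rewrite shs_cons shs0l shs0r expr1 scaleN1r. Qed.

(** * The quasi-isomorphism *)

Section Comparison.
Variables (K : fieldType) (V : vectType K) (n : nat) (U : 'I_n -> {vspace V}).
Hypothesis U_proper : forall i, U i <> fullv.

Lemma atom_nonbot i : atom U i != \bot%O.
Proof.
apply/eqP => /(congr1 (@ssval _ _)); rewrite ssval_atom ssval_bot.
exact: U_proper.
Qed.

(** The right-hand side is antisymmetric in [i] and [j]; it yields anticommutation and vanishing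
    squares at once. *)
Lemma flag1_mul i j :
  @fmul _ _ (flag_data U) (flag1 (atom U i)) (flag1 (atom U j)) =
  lvec [:: atom U i; atom U j] - lvec [:: atom U j; atom U i].
Proof.
rewrite /= (word_flag1 (atom_nonbot i)) (word_flag1 (atom_nonbot j)).
exact: shs11.
Qed.

Lemma atom_flag_morph : is_filt_morph (X := ext_data U)
  (@atom_prod _ _ _ _ (flag_data U) (fun i => flag1 (atom U i))).
Proof.
apply: (atom_prod_morph (flag_is_filt_dga U)) => [i|i|i|i j|i].
- by [].
- by rewrite /= (word_flag1 (atom_nonbot i)).
- exact: (flag1_diff (atom_nonbot i)).
- by rewrite (flag1_mul i j) (flag1_mul j i) opprB.
- by rewrite (flag1_mul i i) subrr.
Qed.

Lemma D_CM_quasi_isomorphic : quasi_isomorphic (D_dga U) (CM_dga U).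
Proof.
have cdP := cd_codim_axioms U.
have XP := ext_is_filt_dga U; have YP := flag_is_filt_dga U.
rewrite (D_dga_gr U_proper) CM_dga_gr.
apply: qi_step (gr_is_dga cdP XP) _ (qi_refl (gr_is_dga cdP YP)).
left; exists (lin_ext (atom_prod (Y := flag_data U) (fun i => flag1 (atom U i)))); split.
  exact: gr_morphism cdP YP atom_flag_morph.
apply: gr_cohomology_iso XP YP atom_flag_morph _ _ _ _.
- exact: ext_has_primitives.
- exact: flag_has_primitives.
- exact: ext_connected.
- exact: flag_connected.
Qed.

End Comparison.

Theorem proposition2p6 (R : realType) (V : vectType R[i]) (n : nat)
    (U : 'I_n -> {vspace V})
    (U_proper : forall i : 'I_n, U i <> fullv)
    (U_antichain : forall i j : 'I_n, (U i <= U j)%VS -> i = j) :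
  quasi_isomorphic (D_dga U) (CM_dga U).
Proof. exact: D_CM_quasi_isomorphic. Qed.
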